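(* Let $q$ be a prime power. The group $A(q)/Z$, where $Z$ is the center of $A(q)$, does not admit a mixed identity.
   Context: Construction of $A(q)$: For $n\in\mathbb{N}$ consider the diagonal embeddings $\iota_n\colon\mathrm{GL}_{2^n}(q)\to\mathrm{GL}_{2^{n+1}}(q)$, $h\mapsto\begin{pmatrix}h&0\\0&h\end{pmatrix}$, and let $\mathrm{GL}_{2^\omega}(q)=\bigcup_{n\in\mathbb{N}}\mathrm{GL}_{2^n}(q)$ be the inductive limit of the chain $(\mathrm{GL}_{2^n}(q),\iota_n)_{n\in\mathbb{N}}$. The normalized rank metric, given for $g,h\in\mathrm{GL}_{2^n}(q)$ by $d(g,h)=2^{-n}\,\mathrm{rk}(g-h)$, is compatible with the embeddings $\iota_n$ and hence is a well-defined bi-invariant metric on $\mathrm{GL}_{2^\omega}(q)$. The group $A(q)$ is the Cauchy completion of $\mathrm{GL}_{2^\omega}(q)$ with respect to this metric. Its center $Z$ is isomorphic to $\mathbb{F}_q^\times$ (scalars). Mixed identities: $\mathbf{F}_r=\langle x_1,\ldots,x_r\rangle$ is the free group of rank $r$. For a group $G$, a mixed identity for $G$ is a non-trivial element $w\in G\ast\mathbf{F}_r$ (for some $r\ge1$) such that $w(h_1,\dots,h_r)=1_G$ for all $h_1,\dots,h_r\in G$, where $w(h_1,\dots,h_r)$ is the image of $w$ under the homomorphism $G\ast\mathbf{F}_r\to G$ that is the identity on $G$ and maps $x_i\mapsto h_i$. *)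

(* Defs.v *)
From HB Require Import structures.
From mathcomp Require Import all_boot all_order all_algebra all_fingroup.
From mathcomp Require Import generic_quotient.
From mathcomp Require Import boolp classical_sets functions filter topology.

Set Implicit Arguments.
Unset Strict Implicit.
Unset Printing Implicit Defensive.

Import Order.TTheory GRing.Theory Num.Theory.
Import numFieldTopology.Exports.

Local Open Scope group_scope.
Local Open Scope quotient_scope.

(* A word in the letters s and s^-1, for s in S; the boolean marks inverses. *)
Definition gword (S : Type) := seq (S * bool).

Section Presentation.
Variables (S : choiceType) (R : gword S -> gword S -> Prop).
Implicit Types u v w : gword S.

Inductive word_congr : gword S -> gword S -> Prop :=
| word_congr_refl u : word_congr u u
| word_congr_sym u v : word_congr u v -> word_congr v u
| word_congr_trans u v w : word_congr u v -> word_congr v w -> word_congr u w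
| word_congr_cat u u' v v' :
    word_congr u u' -> word_congr v v' -> word_congr (u ++ v) (u' ++ v')
| word_congr_cancel s b : word_congr [:: (s, b); (s, ~~ b)] [::]
| word_congr_rel u v : R u v -> word_congr u v.

Definition word_congrb : rel (gword S) := fun u v => `[< word_congr u v >].

Lemma word_congrb_refl : reflexive word_congrb.
Proof. by move=> u; apply/asboolP/word_congr_refl. Qed.

Lemma word_congrb_sym : symmetric word_congrb.
Proof. by move=> u v; apply/asboolP/asboolP => /word_congr_sym. Qed.

Lemma word_congrb_trans : transitive word_congrb.
Proof.
move=> v u w /asboolP uv /asboolP vw; apply/asboolP.
exact: word_congr_trans uv vw.
Qed.

Canonical word_congrb_equiv :=
  EquivRel word_congrb word_congrb_refl word_congrb_sym word_congrb_trans.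

(* The group < S | u = v for all (u, v) in R >. *)
Definition presented := {eq_quot word_congrb}.
HB.instance Definition _ := Choice.on presented.
HB.instance Definition _ := EqQuotient.on presented.

Definition word_inv u : gword S := rev [seq (l.1, ~~ l.2) | l <- u].

Lemma presentedW (P : presented -> Prop) :
  (forall u, P (\pi_presented u)) -> forall x, P x.
Proof. by move=> Pu x; rewrite -[x]reprK. Qed.

Lemma presentedP u v : \pi_presented u = \pi_presented v <-> word_congr u v.
Proof. by split=> [/eqP|?]; [rewrite piE => /asboolP|apply/eqP; rewrite piE; apply/asboolP]. Qed.

Lemma word_inv_catl u : word_congr (word_inv u ++ u) [::].
Proof.
elim: u => [|[s b] u IHu]; first exact: word_congr_refl.
rewrite /word_inv /= rev_cons -/(word_inv u) cat_rcons.
apply: word_congr_trans IHu; apply: word_congr_cat.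
  exact: word_congr_refl.
rewrite -[_ :: _ :: _]/([:: (s, ~~ b); (s, b)] ++ u).
rewrite -[X in word_congr _ X]cat0s; apply: word_congr_cat.
  by rewrite -{2}[b]negbK; apply: word_congr_cancel.
exact: word_congr_refl.
Qed.

Lemma word_inv_catr u : word_congr (u ++ word_inv u) [::].
Proof.
elim: u => [|[s b] u IHu]; first exact: word_congr_refl.
rewrite /word_inv /= rev_cons -/(word_inv u) -cat_cons -cats1 catA.
apply: word_congr_trans (word_congr_cancel s b).
rewrite -[[:: _; _]]/([:: (s, b)] ++ [:: (s, ~~ b)]).
apply: word_congr_cat; last exact: word_congr_refl.
rewrite -[X in word_congr _ X]cats0 cat_cons -cat1s.
by apply: word_congr_cat => //; apply: word_congr_refl.
Qed.

Lemma word_congr_inv u v : word_congr u v -> word_congr (word_inv u) (word_inv v).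
Proof.
move=> uv.
apply: (@word_congr_trans _ (word_inv u ++ (v ++ word_inv v))).
  rewrite -[X in word_congr X _]cats0; apply: word_congr_cat.
    exact: word_congr_refl.
  exact/word_congr_sym/word_inv_catr.
rewrite catA -[X in word_congr _ X]cat0s; apply: word_congr_cat.
  apply: word_congr_trans (word_inv_catl u); apply: word_congr_cat.
    exact: word_congr_refl.
  exact: word_congr_sym.
exact: word_congr_refl.
Qed.

Lemma repr_word_congr u : word_congr (repr (\pi_presented u)) u.
Proof. by apply/presentedP; rewrite reprK. Qed.

Definition pres_one : presented := \pi_presented [::].
Definition pres_mul (x y : presented) : presented :=
  \pi_presented (repr x ++ repr y).
Definition pres_inv (x : presented) : presented :=
  \pi_presented (word_inv (repr x)).

Lemma pres_mulE u v :
  pres_mul (\pi_presented u) (\pi_presented v) = \pi_presented (u ++ v).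
Proof. by apply/presentedP/word_congr_cat; apply: repr_word_congr. Qed.

Lemma pres_invE u : pres_inv (\pi_presented u) = \pi_presented (word_inv u).
Proof. by apply/presentedP/word_congr_inv/repr_word_congr. Qed.

Lemma pres_mulA : associative pres_mul.
Proof.
elim/presentedW=> u; elim/presentedW=> v; elim/presentedW=> w.
by rewrite !pres_mulE catA.
Qed.
Lemma pres_mul1 : left_id pres_one pres_mul.
Proof. by elim/presentedW=> u; rewrite pres_mulE. Qed.
Lemma pres_mulr1 : right_id pres_one pres_mul.
Proof. by elim/presentedW=> u; rewrite pres_mulE cats0. Qed.
Lemma pres_mulV : left_inverse pres_one pres_inv pres_mul.
Proof.
elim/presentedW=> u; rewrite pres_invE pres_mulE.
exact/presentedP/word_inv_catl.
Qed.
Lemma pres_mulrV : right_inverse pres_one pres_inv pres_mul.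
Proof.
elim/presentedW=> u; rewrite pres_invE pres_mulE.
exact/presentedP/word_inv_catr.
Qed.

HB.instance Definition _ := isGroup.Build presented
  pres_mulA pres_mul1 pres_mulr1 pres_mulV pres_mulrV.

Definition pres_gen (s : S) : presented := \pi_presented [:: (s, false)].

Section Lift.
Variables (K : groupType) (f : S -> K).

Definition word_eval (w : gword S) : K :=
  \prod_(l <- w) (if l.2 then (f l.1)^-1 else f l.1).

(* Independent of the representative, hence a homomorphism, as soon as f     *)
(* satisfies the relations.                                                  *)
Definition pres_lift (x : presented) : K := word_eval (repr x).

Hypothesis fR : forall u v, R u v -> word_eval u = word_eval v.

Lemma word_eval_congr u v : word_congr u v -> word_eval u = word_eval v.
Proof.
elim=> {u v} [u|u v _ ->|u v w _ -> _ ->|u u' v v' _ e _ e'|s b|u v /fR] //.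
- by rewrite /word_eval !big_cat; congr (_ * _).
- rewrite /word_eval !big_cons !big_nil mulg1 /=.
  by case: b; rewrite /= ?mulVg ?mulgV.
Qed.

Lemma pres_liftE u : pres_lift (\pi_presented u) = word_eval u.
Proof. exact/word_eval_congr/repr_word_congr. Qed.

Lemma pres_liftM : {morph pres_lift : x y / x * y}.
Proof.
elim/presentedW=> u; elim/presentedW=> v.
rewrite [X in pres_lift X]pres_mulE !pres_liftE.
by rewrite /word_eval big_cat.
Qed.

Lemma pres_lift1 : pres_lift 1 = 1.
Proof. by rewrite [LHS]pres_liftE /word_eval big_nil. Qed.

Lemma pres_lift_gen s : pres_lift (pres_gen s) = f s.
Proof. by rewrite pres_liftE /word_eval big_cons big_nil /= mulg1. Qed.

End Lift.
End Presentation.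

Definition free_group (r : nat) : groupType :=
  presented (fun _ _ : gword 'I_r => False).

Definition fg_var (r : nat) (i : 'I_r) : free_group r := pres_gen _ i.

Definition fg_lift (r : nat) (K : groupType) (h : 'I_r -> K)
  (x : free_group r) : K := pres_lift h x.

Section FreeProduct.
Variables G H : groupType.

Inductive free_product_rel : gword (G + H) -> gword (G + H) -> Prop :=
| free_product_rel_l (a b : G) : free_product_rel
    [:: (inl a, false); (inl b, false)] [:: (inl (a * b), false)]
| free_product_rel_r (a b : H) : free_product_rel
    [:: (inr a, false); (inr b, false)] [:: (inr (a * b), false)].

Definition free_product : groupType := presented free_product_rel.

Definition fp_inl (a : G) : free_product := pres_gen _ (inl a).
Definition fp_inr (b : H) : free_product := pres_gen _ (inr b).

Definition fp_lift (K : groupType) (f : G -> K) (g : H -> K)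
  (x : free_product) : K :=
  pres_lift (fun s => match s with inl a => f a | inr b => g b end) x.

End FreeProduct.

Lemma fg_liftM r (K : groupType) (h : 'I_r -> K) :
  {morph fg_lift h : x y / x * y}.
Proof. exact: pres_liftM. Qed.

Lemma fg_lift_var r (K : groupType) (h : 'I_r -> K) i :
  fg_lift h (fg_var i) = h i.
Proof. exact: pres_lift_gen. Qed.

Section FreeProductLift.
Variables (G H K : groupType) (f : G -> K) (g : H -> K).
Hypotheses (fM : {morph f : x y / x * y}) (gM : {morph g : x y / x * y}).

Let fp_relP u v : free_product_rel u v ->
  word_eval (fun s => match s with inl a => f a | inr b => g b end) u =
  word_eval (fun s => match s with inl a => f a | inr b => g b end) v.
Proof.
by case=> a b; rewrite /word_eval !big_cons !big_nil /= !mulg1 ?fM ?gM.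
Qed.

Lemma fp_liftM : {morph fp_lift f g : x y / x * y}.
Proof. exact: pres_liftM. Qed.

Lemma fp_lift_inl a : fp_lift f g (fp_inl H a) = f a.
Proof. exact: pres_lift_gen. Qed.

Lemma fp_lift_inr b : fp_lift f g (fp_inr G b) = g b.
Proof. exact: pres_lift_gen. Qed.

End FreeProductLift.

Section MixedIdentity.
Variables (G : groupType) (r : nat).

Definition mixed_eval (h : 'I_r -> G) (w : free_product G (free_group r)) : G :=
  fp_lift idfun (fg_lift h) w.

Lemma mixed_evalM h : {morph mixed_eval h : v w / v * w}.
Proof. by apply: fp_liftM => //; apply: fg_liftM. Qed.

Lemma mixed_eval_const h a : mixed_eval h (fp_inl _ a) = a.
Proof. by apply: fp_lift_inl => //; apply: fg_liftM. Qed.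

Lemma mixed_eval_var h i : mixed_eval h (fp_inr _ (fg_var i)) = h i.
Proof.
rewrite /mixed_eval fp_lift_inr ?fg_lift_var//; exact: fg_liftM.
Qed.

Definition mixed_identity (w : free_product G (free_group r)) : Prop :=
  w <> 1 /\ forall h : 'I_r -> G, mixed_eval h w = 1.

End MixedIdentity.

Definition admits_mixed_identity (G : groupType) : Prop :=
  exists (r : nat) (w : free_product G (free_group r)),
    (1 <= r)%N /\ mixed_identity w.

Section CenterQuotient.
Variable G : groupType.

Definition center : {pred G} := fun z => `[< forall x : G, commute z x >].

Definition center_rel : rel G := fun x y => x^-1 * y \in center.

Lemma centerP z : reflect (forall x : G, z * x = x * z) (z \in center).
Proof. exact: asboolP. Qed.

Lemma center_rel_refl : reflexive center_rel.
Proof. by move=> x; apply/centerP => y; rewrite mulVg mul1g mulg1. Qed.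

Lemma center1V z : z \in center -> z^-1 \in center.
Proof.
move=> /centerP cz; apply/centerP => x.
by apply: (mulgI z); rewrite mulgA mulgV mul1g mulgA cz -mulgA mulgV mulg1.
Qed.

Lemma centerM z t : z \in center -> t \in center -> z * t \in center.
Proof.
move=> /centerP cz /centerP ct; apply/centerP => x.
by rewrite -mulgA ct !mulgA cz.
Qed.

Lemma center_rel_sym : symmetric center_rel.
Proof.
suff h x y : center_rel x y -> center_rel y x by move=> x y; apply/idP/idP => /h.
by move=> /center1V; rewrite invgM invgK.
Qed.

Lemma center_rel_trans : transitive center_rel.
Proof.
move=> y x z xy yz; rewrite /center_rel.
have -> : x^-1 * z = (x^-1 * y) * (y^-1 * z) by rewrite mulgA mulgK.
exact: centerM.
Qed.

Canonical center_rel_equiv :=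
  EquivRel center_rel center_rel_refl center_rel_sym center_rel_trans.

Definition center_quotient := {eq_quot center_rel}.
HB.instance Definition _ := Choice.on center_quotient.
HB.instance Definition _ := EqQuotient.on center_quotient.

Lemma center_quotientW (P : center_quotient -> Prop) :
  (forall x, P (\pi_center_quotient x)) -> forall x, P x.
Proof. by move=> Px x; rewrite -[x]reprK. Qed.

Lemma center_quotientP x y :
  \pi_center_quotient x = \pi_center_quotient y <-> x^-1 * y \in center.
Proof. by split=> [/eqP|?]; [rewrite piE|apply/eqP; rewrite piE]. Qed.

Lemma repr_center x : (repr (\pi_center_quotient x))^-1 * x \in center.
Proof. by apply/center_quotientP; rewrite reprK. Qed.

Definition cq_one : center_quotient := \pi_center_quotient 1.
Definition cq_mul (x y : center_quotient) : center_quotient :=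
  \pi_center_quotient (repr x * repr y).
Definition cq_inv (x : center_quotient) : center_quotient :=
  \pi_center_quotient (repr x)^-1.

Lemma cq_mulE x y : cq_mul (\pi_center_quotient x) (\pi_center_quotient y) =
  \pi_center_quotient (x * y).
Proof.
apply/center_quotientP; set a := repr _; set b := repr _.
have ca : a^-1 * x \in center by apply: repr_center.
have cb : b^-1 * y \in center by apply: repr_center.
have -> : (a * b)^-1 * (x * y) = (b^-1 * y) * (a^-1 * x).
  by rewrite invgM -!mulgA; congr (_ * _); rewrite [LHS]mulgA (centerP _ ca).
exact: centerM.
Qed.

Lemma cq_invE x : cq_inv (\pi_center_quotient x) = \pi_center_quotient x^-1.
Proof.
apply/center_quotientP; set a := repr _.
have ca : a^-1 * x \in center by apply: repr_center.
rewrite invgK; have := center1V ca; rewrite invgM invgK => /centerP c.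
suff -> : a * x^-1 = x^-1 * a by apply/centerP.
by apply: (mulIg x); rewrite mulgKV c mulgA mulgV mul1g.
Qed.

Lemma cq_mulA : associative cq_mul.
Proof. by elim/center_quotientW=> x; elim/center_quotientW=> y; elim/center_quotientW=> z; rewrite !cq_mulE mulgA. Qed.
Lemma cq_mul1 : left_id cq_one cq_mul.
Proof. by elim/center_quotientW=> x; rewrite cq_mulE mul1g. Qed.
Lemma cq_mulr1 : right_id cq_one cq_mul.
Proof. by elim/center_quotientW=> x; rewrite cq_mulE mulg1. Qed.
Lemma cq_mulV : left_inverse cq_one cq_inv cq_mul.
Proof. by elim/center_quotientW=> x; rewrite cq_invE cq_mulE mulVg. Qed.
Lemma cq_mulrV : right_inverse cq_one cq_inv cq_mul.
Proof. by elim/center_quotientW=> x; rewrite cq_invE cq_mulE mulgV. Qed.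

HB.instance Definition _ := isGroup.Build center_quotient
  cq_mulA cq_mul1 cq_mulr1 cq_mulV cq_mulrV.

End CenterQuotient.

Section GeneralLinearLimit.
Variable F : finFieldType.

(* {'GL_m[F]} consists of matrices of size m.-1.+1. *)
Lemma double_dim n : ((2 ^ n).-1.+1 + (2 ^ n).-1.+1 = (2 ^ n.+1).-1.+1)%N.
Proof. by rewrite !prednK ?expn_gt0// addnn -mul2n expnS. Qed.

Definition diag_mx2 n (A : 'M[F]_((2 ^ n).-1.+1)) : 'M[F]_((2 ^ n.+1).-1.+1) :=
  castmx (double_dim n, double_dim n) (block_mx A 0 0 A)%R.

Lemma diag_mx2_mul n A B :
  (@diag_mx2 n (A *m B) = diag_mx2 A *m diag_mx2 B)%R.
Proof.
rewrite /diag_mx2; move: (double_dim n); case: _ /; rewrite !castmx_id.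
by rewrite mulmx_block !mul0mx !mulmx0 !addr0 !add0r.
Qed.

Lemma diag_mx2B n A B : @diag_mx2 n (A - B)%R = (diag_mx2 A - diag_mx2 B)%R.
Proof.
rewrite /diag_mx2; move: (double_dim n); case: _ /; rewrite !castmx_id.
by rewrite opp_block_mx add_block_mx !subr0.
Qed.

Lemma diag_mx2_1 n : (@diag_mx2 n 1%:M = 1%:M)%R.
Proof.
rewrite /diag_mx2; move: (double_dim n); case: _ /; rewrite castmx_id.
by rewrite -scalar_mx_block.
Qed.

Lemma rank_diag_mx2 n A : \rank (@diag_mx2 n A) = (\rank A * 2)%N.
Proof.
rewrite /diag_mx2; move: (double_dim n); case: _ /; rewrite castmx_id.
by rewrite rank_diag_block_mx muln2 addnn.
Qed.

Lemma diag_GL_subproof n (g : {'GL_(2 ^ n)[F]}) :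
  diag_mx2 (GLval g) \is a GRing.unit.
Proof.
suff: diag_mx2 (GLval g) \in unitmx by [].
have: (GLval g *m GLval (g^-1)%g = 1%:M)%R by rewrite -GL_MxE mulgV.
by move/(congr1 (@diag_mx2 n)); rewrite diag_mx2_mul diag_mx2_1 => /mulmx1_unit[].
Qed.

Definition diag_GL n (g : {'GL_(2 ^ n)[F]}) : {'GL_(2 ^ n.+1)[F]} :=
  FinRing.unit _ (diag_GL_subproof g).

Lemma diag_GLM n : {morph @diag_GL n : g h / g * h}.
Proof. by move=> g h; apply: val_inj; rewrite /= diag_mx2_mul. Qed.

(* The normalized rank metric takes values in rat, which suffices to express *)
(* Cauchy sequences and their equivalence.                                  *)
Definition rank_dist n (g h : {'GL_(2 ^ n)[F]}) : rat :=
  ((\rank (GLval g - GLval h))%:R / 2 ^+ n)%R.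

Lemma rank_dist_diag n (g h : {'GL_(2 ^ n)[F]}) :
  rank_dist (diag_GL g) (diag_GL h) = rank_dist g h.
Proof.
rewrite /rank_dist /= -diag_mx2B rank_diag_mx2 natrM exprSr invfM.
by rewrite mulrACA mulfV ?mulr1// pnatr_eq0.
Qed.

Lemma rank_dist_refl n (g : {'GL_(2 ^ n)[F]}) : rank_dist g g = 0%R.
Proof. by rewrite /rank_dist subrr mxrank0 mul0r. Qed.

Lemma rank_dist_eq0 n (g h : {'GL_(2 ^ n)[F]}) : rank_dist g h = 0%R -> g = h.
Proof.
move/eqP; rewrite mulf_eq0 invr_eq0 expf_eq0 pnatr_eq0 andbF orbF.
by rewrite mxrank_eq0 subr_eq0 => /eqP/val_inj.
Qed.

Lemma rank_dist_sym n (g h : {'GL_(2 ^ n)[F]}) : rank_dist g h = rank_dist h g.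
Proof. by rewrite /rank_dist -mxrank_opp opprB. Qed.

Lemma rank_dist_triangle n (h g k : {'GL_(2 ^ n)[F]}) :
  (rank_dist g k <= rank_dist g h + rank_dist h k)%R.
Proof.
rewrite /rank_dist -mulrDl ler_pM2r ?invr_gt0 ?exprn_gt0// -natrD ler_nat.
by rewrite -(subrKA (GLval h)) mxrank_add.
Qed.

Lemma rank_distMl n (k g h : {'GL_(2 ^ n)[F]}) :
  rank_dist (k * g) (k * h) = rank_dist g h.
Proof.
rewrite /rank_dist !GL_MxE -mulmxBr -mxrank_tr trmx_mul.
by rewrite mxrankMfree ?mxrank_tr// row_free_unit unitmx_tr GL_unitmx.
Qed.

Lemma rank_distMr n (k g h : {'GL_(2 ^ n)[F]}) :
  rank_dist (g * k) (h * k) = rank_dist g h.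
Proof.
rewrite /rank_dist !GL_MxE -mulmxBl.
by rewrite mxrankMfree// row_free_unit GL_unitmx.
Qed.

(* Elements of the chain are pairs (n, g) with g in GL_{2^n}(F). *)
Definition GLchain := {n : nat & {'GL_(2 ^ n)[F]}}.
Implicit Types s t : GLchain.

Definition chain_elt n (g : {'GL_(2 ^ n)[F]}) : GLchain :=
  Tagged (fun n => {'GL_(2 ^ n)[F]}) g.

Definition chain_step s : GLchain := chain_elt (diag_GL (tagged s)).

Lemma tag_iter_step k s : tag (iter k chain_step s) = (k + tag s)%N.
Proof. by elim: k => //= k ->. Qed.

(* (n, g) and (m, h) are identified when they have a common image; since     *)
(* the images are compared in GLchain, they live at the same level.          *)
Definition chain_eq : rel GLchain := fun s t =>
  `[< exists k l, iter k chain_step s = iter l chain_step t >].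

Lemma chain_eq_refl : reflexive chain_eq.
Proof. by move=> s; apply/asboolP; exists 0%N, 0%N. Qed.

Lemma chain_eq_sym : symmetric chain_eq.
Proof. by move=> s t; apply/asboolP/asboolP => -[k [l e]]; exists l, k. Qed.

Lemma chain_eq_trans : transitive chain_eq.
Proof.
move=> t s u /asboolP[k [l e]] /asboolP[m [n e']]; apply/asboolP.
exists (m + k)%N, (l + n)%N.
by rewrite iterD e -iterD addnC iterD e' -iterD.
Qed.

Canonical chain_equiv :=
  EquivRel chain_eq chain_eq_refl chain_eq_sym chain_eq_trans.

Definition GLlim := {eq_quot chain_eq}.
HB.instance Definition _ := Choice.on GLlim.
HB.instance Definition _ := EqQuotient.on GLlim.

Definition GLlim_in n (g : {'GL_(2 ^ n)[F]}) : GLlim := \pi_GLlim (chain_elt g).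

(* Operations on the chain are computed at the common level tag s + tag t:   *)
(* tagged_as u v is the second component of v, cast to the level of u.       *)
Definition chain_mul s t : GLchain :=
  let u := iter (tag t) chain_step s in
  let v := iter (tag s) chain_step t in
  chain_elt (tagged u * tagged_as u v).

Definition chain_dist s t : rat :=
  let u := iter (tag t) chain_step s in
  let v := iter (tag s) chain_step t in
  rank_dist (tagged u) (tagged_as u v).

Definition chain_inv s : GLchain := chain_elt (tagged s)^-1.

Lemma GLlimP s t : \pi_GLlim s = \pi_GLlim t <->
  exists k l, iter k chain_step s = iter l chain_step t.
Proof.
by split=> [/eqP|?]; [rewrite piE => /asboolP|apply/eqP; rewrite piE; apply/asboolP].
Qed.

Lemma GLlim_in_step s : \pi_GLlim (chain_step s) = \pi_GLlim s.
Proof. by apply/GLlimP; exists 0%N, 1%N. Qed.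

Lemma GLlim_in_iter k s : \pi_GLlim (iter k chain_step s) = \pi_GLlim s.
Proof. by elim: k => //= k <-; rewrite GLlim_in_step. Qed.

Lemma GLlim_in_diag n (g : {'GL_(2 ^ n)[F]}) : GLlim_in (diag_GL g) = GLlim_in g.
Proof. by rewrite /GLlim_in -[RHS]GLlim_in_step. Qed.

Lemma GLlim_lvl (x : GLlim) : exists n, forall m, (n <= m)%N ->
  exists g : {'GL_(2 ^ m)[F]}, x = GLlim_in g.
Proof.
rewrite -[x]reprK; move: (repr x) => {}s; exists (tag s) => m le_sm.
have := tag_iter_step (m - tag s) s; have := GLlim_in_iter (m - tag s) s.
rewrite subnK//; case: (iter _ _ s) => j g /= <- ej.
by move: g; rewrite ej => g; exists g.
Qed.

Lemma GLlim_lvl2 (x y : GLlim) :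
  exists n (g h : {'GL_(2 ^ n)[F]}), x = GLlim_in g /\ y = GLlim_in h.
Proof.
have [n xn] := GLlim_lvl x; have [m ym] := GLlim_lvl y.
have [g ->] := xn (maxn n m) (leq_maxl _ _).
have [h ->] := ym (maxn n m) (leq_maxr _ _).
by exists (maxn n m), g, h.
Qed.

Lemma GLlim_lvl3 (x y z : GLlim) : exists n (g h k : {'GL_(2 ^ n)[F]}),
  [/\ x = GLlim_in g, y = GLlim_in h & z = GLlim_in k].
Proof.
have [n xn] := GLlim_lvl x; have [m ym] := GLlim_lvl y.
have [p zp] := GLlim_lvl z.
have [g ->] := xn (maxn (maxn n m) p) (leq_trans (leq_maxl _ _) (leq_maxl _ _)).
have [h ->] := ym (maxn (maxn n m) p) (leq_trans (leq_maxr _ _) (leq_maxl _ _)).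
have [k ->] := zp (maxn (maxn n m) p) (leq_maxr _ _).
by exists (maxn (maxn n m) p), g, h, k.
Qed.

Lemma iter_chain_mul j s t : tag s = tag t ->
  iter j chain_step (chain_elt (tagged s * tagged_as s t)) =
  let u := iter j chain_step s in let v := iter j chain_step t in
  chain_elt (tagged u * tagged_as u v).
Proof.
case: s t => n g [m h] /= e; case: m / e h => h /=.
rewrite tagged_asE; elim: j => [|j IHj] /=; first by rewrite tagged_asE.
rewrite IHj.
rewrite -/(chain_elt g) -/(chain_elt h).
have: tag (iter j chain_step (chain_elt g)) = tag (iter j chain_step (chain_elt h)).
  by rewrite !tag_iter_step.
case: (iter j _ _) => a x; case: (iter j _ _) => b y /= e.
case: b / e y => y.
by rewrite /chain_step /= !tagged_asE diag_GLM.
Qed.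

Lemma iter_chain_dist j s t : tag s = tag t ->
  let u := iter j chain_step s in let v := iter j chain_step t in
  rank_dist (tagged u) (tagged_as u v) = rank_dist (tagged s) (tagged_as s t).
Proof.
case: s t => n g [m h] /= e; case: m / e h => h /=.
rewrite tagged_asE; elim: j => [|j IHj] /=; first by rewrite tagged_asE.
rewrite -{}IHj.
rewrite -/(chain_elt g) -/(chain_elt h).
have: tag (iter j chain_step (chain_elt g)) = tag (iter j chain_step (chain_elt h)).
  by rewrite !tag_iter_step.
case: (iter j _ _) => a x; case: (iter j _ _) => b y /= e.
case: b / e y => y.
by rewrite /chain_step /= !tagged_asE rank_dist_diag.
Qed.

Lemma iter_chain_inv j s :
  iter j chain_step (chain_inv s) = chain_inv (iter j chain_step s).
Proof.
elim: j => //= j ->; case: (iter j _ s) => n g.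
congr chain_elt; apply: (@mulgI _ (diag_GL g)) => /=.
rewrite -diag_GLM !mulgV; apply: val_inj; exact: diag_mx2_1.
Qed.

Lemma repr_GLlim_in2 n (g h : {'GL_(2 ^ n)[F]}) :
  exists j k l,
    iter j chain_step (repr (GLlim_in g)) = iter l chain_step (chain_elt g) /\
    iter k chain_step (repr (GLlim_in h)) = iter l chain_step (chain_elt h).
Proof.
have /GLlimP[a [b e]] : \pi_GLlim (repr (GLlim_in g)) = \pi_GLlim (chain_elt g).
  by rewrite reprK.
have /GLlimP[c [d e']] : \pi_GLlim (repr (GLlim_in h)) = \pi_GLlim (chain_elt h).
  by rewrite reprK.
exists (d + a)%N, (b + c)%N, (b + d)%N.
by rewrite iterD e -iterD addnC; split => //; rewrite iterD e' -iterD.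
Qed.

Definition GLlim_one : GLlim := @GLlim_in 0%N 1.
Definition GLlim_mul (x y : GLlim) : GLlim :=
  \pi_GLlim (chain_mul (repr x) (repr y)).
Definition GLlim_inv (x : GLlim) : GLlim := \pi_GLlim (chain_inv (repr x)).
Definition GLlim_dist (x y : GLlim) : rat := chain_dist (repr x) (repr y).

Lemma GLlim_in1 n : @GLlim_in n 1 = GLlim_one.
Proof.
elim: n => // n <-; rewrite -[RHS]GLlim_in_diag; congr GLlim_in.
by apply: val_inj; rewrite /= diag_mx2_1.
Qed.

Lemma GLlim_levels s t j k (u v : GLchain) :
  iter j chain_step s = u -> iter k chain_step t = v -> tag u = tag v ->
  [/\ tag (iter (tag t) chain_step s) = tag (iter (tag s) chain_step t),
      iter j chain_step (iter (tag t) chain_step s) = iter (tag t) chain_step u &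
      iter j chain_step (iter (tag s) chain_step t) = iter (tag t) chain_step v].
Proof.
move=> <- <-; rewrite !tag_iter_step => e.
split; first by rewrite addnC.
  by rewrite -!iterD addnC.
by rewrite -!iterD e addnC.
Qed.

Lemma GLlim_inM n (g h : {'GL_(2 ^ n)[F]}) :
  GLlim_in (g * h) = GLlim_mul (GLlim_in g) (GLlim_in h).
Proof.
have [j [k [l [e e']]]] := repr_GLlim_in2 g h.
rewrite /GLlim_mul; set s := repr _ in e *; set t := repr _ in e' *.
have [|et es1 et1] := GLlim_levels e e'; first by rewrite !tag_iter_step.
rewrite -[RHS](GLlim_in_iter j) /chain_mul iter_chain_mul//= es1 et1.
rewrite -!iterD.
have /= := @iter_chain_mul (tag t + l) (chain_elt g) (chain_elt h) erefl.
by rewrite tagged_asE => <-; rewrite GLlim_in_iter.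
Qed.

Lemma GLlim_distE n (g h : {'GL_(2 ^ n)[F]}) :
  GLlim_dist (GLlim_in g) (GLlim_in h) = rank_dist g h.
Proof.
have [j [k [l [e e']]]] := repr_GLlim_in2 g h.
rewrite /GLlim_dist; set s := repr _ in e *; set t := repr _ in e' *.
have [|et es1 et1] := GLlim_levels e e'; first by rewrite !tag_iter_step.
rewrite /chain_dist -(iter_chain_dist j)//= es1 et1.
rewrite -!iterD.
have /= := @iter_chain_dist (tag t + l) (chain_elt g) (chain_elt h) erefl.
by rewrite tagged_asE.
Qed.

Lemma GLlim_inV n (g : {'GL_(2 ^ n)[F]}) :
  GLlim_in g^-1 = GLlim_inv (GLlim_in g).
Proof.
have [j [_ [l [e _]]]] := repr_GLlim_in2 g g.
rewrite /GLlim_inv -[RHS](GLlim_in_iter j) iter_chain_inv e -iter_chain_inv.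
by rewrite GLlim_in_iter.
Qed.

Lemma GLlim_mulA : associative GLlim_mul.
Proof.
move=> x y z; have [n [g [h [k [-> -> ->]]]]] := GLlim_lvl3 x y z.
by rewrite -!GLlim_inM mulgA.
Qed.
Lemma GLlim_mul1 : left_id GLlim_one GLlim_mul.
Proof.
move=> x; have [n [g [_ [-> _]]]] := GLlim_lvl2 x x.
by rewrite -(GLlim_in1 n) -GLlim_inM mul1g.
Qed.
Lemma GLlim_mulr1 : right_id GLlim_one GLlim_mul.
Proof.
move=> x; have [n [g [_ [-> _]]]] := GLlim_lvl2 x x.
by rewrite -(GLlim_in1 n) -GLlim_inM mulg1.
Qed.
Lemma GLlim_mulV : left_inverse GLlim_one GLlim_inv GLlim_mul.
Proof.
move=> x; have [n [g [_ [-> _]]]] := GLlim_lvl2 x x.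
by rewrite -GLlim_inV -GLlim_inM mulVg GLlim_in1.
Qed.
Lemma GLlim_mulrV : right_inverse GLlim_one GLlim_inv GLlim_mul.
Proof.
move=> x; have [n [g [_ [-> _]]]] := GLlim_lvl2 x x.
by rewrite -GLlim_inV -GLlim_inM mulgV GLlim_in1.
Qed.

HB.instance Definition _ := isGroup.Build GLlim
  GLlim_mulA GLlim_mul1 GLlim_mulr1 GLlim_mulV GLlim_mulrV.

Lemma GLlim_dist_refl x : GLlim_dist x x = 0%R.
Proof.
by have [n [g [_ [-> _]]]] := GLlim_lvl2 x x; rewrite GLlim_distE rank_dist_refl.
Qed.
Lemma GLlim_dist_eq0 x y : GLlim_dist x y = 0%R -> x = y.
Proof.
have [n [g [h [-> ->]]]] := GLlim_lvl2 x y.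
by rewrite GLlim_distE => /rank_dist_eq0 ->.
Qed.
Lemma GLlim_dist_sym x y : GLlim_dist x y = GLlim_dist y x.
Proof.
have [n [g [h [-> ->]]]] := GLlim_lvl2 x y.
by rewrite !GLlim_distE rank_dist_sym.
Qed.
Lemma GLlim_dist_triangle y x z :
  (GLlim_dist x z <= GLlim_dist x y + GLlim_dist y z)%R.
Proof.
have [n [g [h [k [-> -> ->]]]]] := GLlim_lvl3 x y z.
by rewrite !GLlim_distE rank_dist_triangle.
Qed.

HB.instance Definition _ := isMetric.Build rat GLlim
  GLlim_dist_refl GLlim_dist_eq0 GLlim_dist_sym GLlim_dist_triangle.

Lemma GLlim_morphM n : {morph @GLlim_in n : g h / g * h}.
Proof. exact: GLlim_inM. Qed.

Lemma GLlim_mdistE n (g h : {'GL_(2 ^ n)[F]}) :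
  mdist (GLlim_in g) (GLlim_in h) = rank_dist g h.
Proof. exact: GLlim_distE. Qed.

Lemma GLlim_distMl (z x y : GLlim) : mdist (z * x) (z * y) = mdist x y.
Proof.
have [n [k [g [h [-> -> ->]]]]] := GLlim_lvl3 z x y.
by rewrite -!GLlim_morphM !GLlim_mdistE rank_distMl.
Qed.
Lemma GLlim_distMr (z x y : GLlim) : mdist (x * z) (y * z) = mdist x y.
Proof.
have [n [k [g [h [-> -> ->]]]]] := GLlim_lvl3 z x y.
by rewrite -!GLlim_morphM !GLlim_mdistE rank_distMr.
Qed.

End GeneralLinearLimit.

HB.mixin Record isBiinvariant G of monoid.Group G & Metric rat G := {
  mdistMl : forall z x y : G, mdist (z * x) (z * y) = mdist x y;
  mdistMr : forall z x y : G, mdist (x * z) (y * z) = mdist x y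
}.

#[short(type="biinvGroupType")]
HB.structure Definition BiinvGroup :=
  {G of isBiinvariant G & monoid.Group G & Metric rat G}.

HB.instance Definition _ (F : finFieldType) :=
  isBiinvariant.Build (GLlim F) (@GLlim_distMl F) (@GLlim_distMr F).

Section Completion.
Variable G : biinvGroupType.
Implicit Types u v w : nat -> G.

Definition cauchy_seq u : Prop := cauchy (u @ \oo)%classic.

Definition null_dist u v : Prop :=
  ((mdist (u n) (v n) : rat^o) @[n --> \oo] --> (0%R : rat^o))%classic.

Lemma cauchy_seqP u : cauchy_seq u <-> forall e : rat, (0 < e)%R ->
  exists N, forall m n, (N <= m)%N -> (N <= n)%N -> (mdist (u m) (u n) < e)%R.
Proof.
rewrite /cauchy_seq -cauchy_ballP; split=> [cu e /cu|cu e e0].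
  case=> -[P Q] /= [[M _ uP] [N _ uQ]] PQ; exists (maxn M N) => m n.
  rewrite !geq_max => /andP[Mm _] /andP[_ Nn].
  have := PQ (u m, u n) (conj (uP _ Mm) (uQ _ Nn)).
  by rewrite /= ballEmdist.
have [N uN] := cu e e0.
pose A := [set x | exists2 n, (N <= n)%N & x = u n]%classic.
have uA : nbhs (u @ \oo)%classic A by exists N => // n /= Nn; exists n.
exists (A, A) => //= -[x y] /= [[m Nm ->] [n Nn ->]].
by rewrite ballEmdist; exact: uN.
Qed.

Lemma null_distP u v : null_dist u v <-> forall e : rat, (0 < e)%R ->
  exists N, forall n, (N <= n)%N -> (mdist (u n) (v n) < e)%R.
Proof.
have absd n : (`|0 - mdist (u n) (v n)| = mdist (u n) (v n))%R.
  by rewrite sub0r normrN ger0_norm// mdist_ge0.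
split=> [/cvg_ballP duv e /duv [N _ uvN]|duv].
  by exists N => n /uvN; rewrite /ball /= absd.
apply/cvg_ballP => e /duv[N uvN].
by exists N => // n /= /uvN; rewrite /ball /= absd.
Qed.

Lemma mdistMM (x x' y y' : G) :
  (mdist (x * y)%g (x' * y')%g <= mdist x x' + mdist y y')%R.
Proof.
by rewrite (le_trans (metric_triangle _ (x' * y) _))// mdistMr mdistMl.
Qed.

Lemma mdistV (x y : G) : mdist x^-1 y^-1 = mdist x y.
Proof.
by rewrite -(mdistMl x) -(mdistMr y) mulgV mul1g mulgKV metric_sym.
Qed.

Lemma null_dist_refl u : null_dist u u.
Proof. by apply/null_distP => e e0; exists 0%N => n _; rewrite mdistxx. Qed.

Lemma null_dist_sym u v : null_dist u v -> null_dist v u.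
Proof.
move=> /null_distP uv; apply/null_distP => e /uv[N uvN].
by exists N => n /uvN; rewrite metric_sym.
Qed.

Lemma null_dist_trans u v w : null_dist u v -> null_dist v w -> null_dist u w.
Proof.
move=> /null_distP uv /null_distP vw; apply/null_distP => e e0.
have e20 : (0 < e / 2)%R by rewrite divr_gt0.
have [M uvM] := uv _ e20; have [N vwN] := vw _ e20; exists (maxn M N) => n.
rewrite geq_max => /andP[/uvM d1 /vwN d2].
by rewrite (le_lt_trans (metric_triangle _ (v n) _))// (splitr e) ltrD.
Qed.

Definition cauchy_sequence := {u : nat -> G | `[< cauchy_seq u >]}.
Implicit Types x y : cauchy_sequence.

Definition completion_rel : rel cauchy_sequence :=
  fun x y => `[< null_dist (val x) (val y) >].

Lemma completion_rel_refl : reflexive completion_rel.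
Proof. by move=> x; apply/asboolP/null_dist_refl. Qed.
Lemma completion_rel_sym : symmetric completion_rel.
Proof. by move=> x y; apply/asboolP/asboolP => /null_dist_sym. Qed.
Lemma completion_rel_trans : transitive completion_rel.
Proof.
move=> y x z /asboolP xy /asboolP yz; apply/asboolP.
exact: null_dist_trans xy yz.
Qed.

Canonical completion_equiv := EquivRel completion_rel
  completion_rel_refl completion_rel_sym completion_rel_trans.

Definition completion := {eq_quot completion_rel}.
HB.instance Definition _ := Choice.on completion.
HB.instance Definition _ := EqQuotient.on completion.

Lemma completionW (P : completion -> Prop) :
  (forall x, P (\pi_completion x)) -> forall a : completion, P a.
Proof. by move=> Px a; rewrite -[a]reprK. Qed.

Lemma completionP x y :
  \pi_completion x = \pi_completion y <-> null_dist (val x) (val y).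
Proof.
by split=> [/eqP|?]; [rewrite piE => /asboolP|apply/eqP; rewrite piE; apply/asboolP].
Qed.

Lemma repr_completion x : null_dist (val (repr (\pi_completion x))) (val x).
Proof. by apply/completionP; rewrite reprK. Qed.

Lemma cauchy_const_subproof (a : G) : `[< cauchy_seq (fun=> a) >].
Proof.
by apply/asboolP/cauchy_seqP => e e0; exists 0%N => m n _ _; rewrite mdistxx.
Qed.

Definition cauchy_const (a : G) : cauchy_sequence :=
  exist _ (fun=> a) (cauchy_const_subproof a).

Lemma cauchy_mul_subproof x y : `[< cauchy_seq (fun n => val x n * val y n) >].
Proof.
have /asboolP/cauchy_seqP cx := valP x; have /asboolP/cauchy_seqP cy := valP y.
apply/asboolP/cauchy_seqP => e e0.
have e20 : (0 < e / 2)%R by rewrite divr_gt0.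
have [M xM] := cx _ e20; have [N yN] := cy _ e20; exists (maxn M N) => m n.
rewrite !geq_max => /andP[Mm Nm] /andP[Mn Nn].
by rewrite (le_lt_trans (mdistMM _ _ _ _))// (splitr e) ltrD ?xM ?yN.
Qed.

Definition cauchy_mul x y : cauchy_sequence :=
  exist _ (fun n => val x n * val y n) (cauchy_mul_subproof x y).

Lemma cauchy_inv_subproof x : `[< cauchy_seq (fun n => (val x n)^-1) >].
Proof.
have /asboolP/cauchy_seqP cx := valP x.
apply/asboolP/cauchy_seqP => e /cx[N xN].
by exists N => m n Nm Nn; rewrite mdistV xN.
Qed.

Definition cauchy_inv x : cauchy_sequence :=
  exist _ (fun n => (val x n)^-1) (cauchy_inv_subproof x).

Definition completion_in (a : G) : completion := \pi_completion (cauchy_const a).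

Definition completion_one : completion := completion_in 1.
Definition completion_mul (a b : completion) : completion :=
  \pi_completion (cauchy_mul (repr a) (repr b)).
Definition completion_inv (a : completion) : completion :=
  \pi_completion (cauchy_inv (repr a)).

Lemma completion_mulE x y :
  completion_mul (\pi_completion x) (\pi_completion y) =
  \pi_completion (cauchy_mul x y).
Proof.
apply/completionP/null_distP => e e0.
have /null_distP dx := repr_completion x; have /null_distP dy := repr_completion y.
have e20 : (0 < e / 2)%R by rewrite divr_gt0.
have [M xM] := dx _ e20; have [N yN] := dy _ e20; exists (maxn M N) => n.
rewrite geq_max => /andP[Mn Nn].
by rewrite (le_lt_trans (mdistMM _ _ _ _))// (splitr e) ltrD ?xM ?yN.
Qed.

Lemma completion_invE x :
  completion_inv (\pi_completion x) = \pi_completion (cauchy_inv x).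
Proof.
apply/completionP/null_distP => e.
have /null_distP dx := repr_completion x; move=> /dx[N xN].
by exists N => n Nn; rewrite /= mdistV xN.
Qed.

Lemma eq_completion x y :
  val x =1 val y -> \pi_completion x = \pi_completion y.
Proof. by move=> /funext xy; congr \pi; apply: val_inj. Qed.

Lemma completion_mulA : associative completion_mul.
Proof.
elim/completionW=> x; elim/completionW=> y; elim/completionW=> z.
by rewrite !completion_mulE; apply: eq_completion => n /=; rewrite mulgA.
Qed.
Lemma completion_mul1 : left_id completion_one completion_mul.
Proof.
elim/completionW=> x; rewrite completion_mulE.
by apply: eq_completion => n /=; rewrite mul1g.
Qed.
Lemma completion_mulr1 : right_id completion_one completion_mul.
Proof.
elim/completionW=> x; rewrite completion_mulE.
by apply: eq_completion => n /=; rewrite mulg1.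
Qed.
Lemma completion_mulV :
  left_inverse completion_one completion_inv completion_mul.
Proof.
elim/completionW=> x; rewrite completion_invE completion_mulE.
by apply: eq_completion => n /=; rewrite mulVg.
Qed.
Lemma completion_mulrV :
  right_inverse completion_one completion_inv completion_mul.
Proof.
elim/completionW=> x; rewrite completion_invE completion_mulE.
by apply: eq_completion => n /=; rewrite mulgV.
Qed.

HB.instance Definition _ := isGroup.Build completion
  completion_mulA completion_mul1 completion_mulr1
  completion_mulV completion_mulrV.

End Completion.

(* A(q) for q = #|F|. *)
Definition Aq (F : finFieldType) : groupType := completion (GLlim F).

(* Main.v *)
(* Let V = F^N and let w = c_0 x_(i_1)^(e_1) c_1 ... c_l be a word over       *)
(* GL(V), acting on row vectors. Say that c_j is critical if its neighbouring *)
(* letters are mutually inverse, and assume that rank (c_j - a) >= K for all  *)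
(* scalars a and all critical c_j. We choose the values h_i of the variables  *)
(* as partial isomorphisms that grow along the trajectory of a vector: as     *)
(* long as the span W of all vectors used so far has dimension < K - 1, a new *)
(* vector v can be prescribed as the next point such that v and v c_j avoid W *)
(* (and v c_j avoids W + <v> if c_j is critical), so that the next letter is  *)
(* still undefined at v c_j. In this way about K / (2 l + 2) independent      *)
(* vectors x are moved by w(h) to vectors z with all x and z independent, and *)
(* then w(h) g - g w(h) has rank >= K / (2 l + 2) for some g.                 *)
(*   This bound is linear in N when K is, and it does not depend on the level *)
(* of the chain GL_(2^n)(F). A word over A(q)/Z is brought into reduced form, *)
(* where the critical constants are nontrivial; their representatives do not  *)
(* commute with some element of A(q), so close approximations at finite level *)
(* are linearly far from the scalars. Since word maps are Lipschitz in the    *)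
(* constants, uniformly in the variables, h and g found for one approximation *)
(* show that w(h) is not central in A(q).                                     *)

Require Import Defs.
From mathcomp Require Import all_boot all_order all_algebra all_fingroup.
From mathcomp Require Import generic_quotient boolp topology ring lra.

Set Implicit Arguments.
Unset Strict Implicit.
Unset Printing Implicit Defensive.

Import Order.TTheory GRing.Theory Num.Theory.

(** * Row spaces *)

(** Noncommutation of word values is made quantitative in finite dimension and then carried to the
    completion. [trajectory] prescribes partial values of the variables along the path of one
    vector, and [many_trajectories] repeats this for independent vectors.
    [exists_far_from_commuting] turns the result into a rank bound for [w(h) g - g w(h)], and
    [GLlim_word_far] normalizes it to a distance that no longer depends on the matrix size.

    For constants in the completion, a noncentral one has approximations uniformly far from
    commuting with suitable elements ([noncentral_approx]), hence linearly far from the scalars in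
    rank ([far_from_center_rank]). Replacing constants by approximations changes word values by an
    error uniform in [h] ([word_value_cauchy]), so a choice of [h] and [g] for one approximation
    survives the limit ([Aq_word_noncentral]). By [free_product_normal_form] only reduced words
    matter; over the quotient their critical constants are nontrivial and lift to noncentral
    elements. *)

Section RowSpaces.
Variables (F : fieldType) (N : nat).
Implicit Types (u v w : 'rV[F]_N) (A B W c : 'M[F]_N).
Local Open Scope ring_scope.

Lemma exists_notin_submx m (A : 'M[F]_(m, N)) :
  (\rank A < N)%N -> exists v : 'rV_N, ~~ (v <= A)%MS.
Proof.
move=> rA; have : ~~ row_full A by rewrite /row_full neq_ltn rA.
rewrite -sub1mx => /row_subPn[i vA].
by exists (row i 1%:M).
Qed.

Lemma addmx_subl m1 m2 (A1 A2 : 'M[F]_(m1, N)) (B : 'M_(m2, N)) :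
  (A1 <= B)%MS -> ((A1 + A2)%R <= B)%MS = (A2 <= B)%MS.
Proof.
move=> A1B; apply/idP/idP => [A12|A2B]; last by rewrite addmx_sub.
by rewrite -(addKr A1 A2) addmx_sub ?eqmx_opp.
Qed.

Lemma submx_subr m1 m2 (A1 A2 : 'M[F]_(m1, N)) (B : 'M_(m2, N)) :
  (A1 <= B)%MS -> (A2 <= B)%MS -> ((A1 - A2)%R <= B)%MS.
Proof. by move=> A1B A2B; rewrite addmx_sub// eqmx_opp. Qed.

Lemma addmx_subr m1 m2 (A1 A2 : 'M[F]_(m1, N)) (B : 'M_(m2, N)) :
  (A2 <= B)%MS -> ((A1 + A2)%R <= B)%MS = (A1 <= B)%MS.
Proof. by rewrite addrC; apply: addmx_subl. Qed.

(** A vector space is not the union of two proper subspaces. *)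
Lemma exists_notin_submx2 A B : (\rank A < N)%N -> (\rank B < N)%N ->
  exists2 v : 'rV_N, ~~ (v <= A)%MS & ~~ (v <= B)%MS.
Proof.
move=> /exists_notin_submx[u uA] /exists_notin_submx[v vB].
have [uB|] := boolP (u <= B)%MS; last by exists u.
have [vA|] := boolP (v <= A)%MS; last by exists v.
by exists (u + v); [rewrite addmx_subr | rewrite addmx_subl].
Qed.

Lemma mulmx_sub_invmx u c W :
  c \in unitmx -> (u *m c <= W)%MS = (u <= W *m invmx c)%MS.
Proof.
move=> cU; apply/idP/idP => [uW|uW].
  by rewrite -(mulmxK cU u) submxMr.
by rewrite -(mulmxKV cU W) submxMr.
Qed.

Lemma exists_moved c W : c \in unitmx -> (\rank W < N)%N ->
  exists2 v : 'rV_N, ~~ (v <= W)%MS & ~~ (v *m c <= W)%MS.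
Proof.
move=> cU rW; have [||v vW vc] := @exists_notin_submx2 W (W *m invmx c) => //.
  by rewrite mxrankMfree// row_free_unit unitmx_inv.
by exists v => //; rewrite mulmx_sub_invmx.
Qed.

Lemma sub_addsmx_row u v W :
  (u <= W + v)%MS -> exists a, ((u - a *: v)%R <= W)%MS.
Proof.
case/sub_addsmxP => -[x y] /= ->; exists (y 0 0).
by rewrite [y]mx11_scalar mxE mulr1n mul_scalar_mx addrK submxMl.
Qed.

Lemma rank_adds_row m u (A : 'M[F]_(m, N)) :
  (\rank (A + u)%MS <= (\rank A).+1)%N.
Proof.
apply: leq_trans (mxrank_adds_leqif _ _).1 _.
by rewrite -[X in (_ <= X)%N]addn1 leq_add2l rank_leq_row.
Qed.

(* If [v c] lies in [W + <v>] for all [v] outside [W], then [c] induces a     *)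
(* homothety of [V / W], whence [rank (c - a) <= rank W] for its ratio [a].  *)
Lemma exists_moved_mod c W : ((\rank W).+1 < N)%N ->
  (forall a : F, (\rank W < \rank (c - a%:M)%R)%N) ->
  exists2 v : 'rV_N, ~~ (v <= W)%MS & ~~ (v *m c <= W + v)%MS.
Proof.
move=> rW rc; apply: contrapT => nex.
have {nex} hom v : ~~ (v <= W)%MS -> exists a, ((v *m c - a *: v)%R <= W)%MS.
  move=> vW; apply: sub_addsmx_row; apply: contrapT => /negP vc.
  by apply: nex; exists v.
have [v vW] := @exists_notin_submx _ W (ltnW rW).
have [a va] := hom v vW.
have rWv : (\rank (W + v)%MS < N)%N.
  by apply: leq_ltn_trans rW; exact: rank_adds_row.
(* For [u] independent of [v] modulo [W], the ratios of [u] and [v] both equal that of [u + v]. *)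
have ratio u : ~~ (u <= W + v)%MS -> (u *m (c - a%:M)%R <= W)%MS.
  move=> uWv.
  have uW : ~~ (u <= W)%MS.
    by apply: contra uWv => /submx_trans->//; exact: addsmxSl.
  have [b ub] := hom u uW.
  have uvW : ~~ ((u + v)%R <= W)%MS.
    apply: contra uWv => uv; rewrite -(addrK v u) submx_subr ?addsmxSr//.
    exact: submx_trans uv (addsmxSl _ _).
  have [d uvd] := hom _ uvW.
  have E : (((d - b) *: u + (d - a) *: v)%R <= W)%MS.
    have -> : (d - b) *: u + (d - a) *: v =
        (u *m c - b *: u) + (v *m c - a *: v) - ((u + v) *m c - d *: (u + v)).
      rewrite mulmxDl; move: (u *m c) (v *m c) => x y.
      by apply/rowP => j; rewrite !mxE; ring.
    exact: submx_subr (addmx_sub _ _) _.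
  have db : d = b.
    apply/eqP; apply: contraNT uWv; rewrite -subr_eq0 => db0.
    rewrite -(scalerK db0 u) scalemx_sub// -(addrK ((d - a) *: v) (_ *: u)).
    rewrite submx_subr ?(submx_trans E) ?addsmxSl//.
    by rewrite scalemx_sub ?addsmxSr.
  have da : d = a.
    apply/eqP; apply: contraNT vW; rewrite -subr_eq0 => da0.
    by move: E; rewrite -db subrr scale0r add0r => /(scalemx_sub (d - a)^-1);
       rewrite scalerK.
  by rewrite mulmxBr mul_mx_scalar -da db.
have [u uWv] := @exists_notin_submx _ _ rWv.
have := rc a; rewrite ltnNge => /negP; apply; apply: mxrankS.
apply/row_subP => i; rewrite rowE; set x := delta_mx _ _.
(* A vector of [W + <v>] is a difference of two vectors outside it. *)
have [xWv|] := boolP (x <= W + v)%MS; last exact: ratio.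
rewrite -(addrK u x) mulmxBl submx_subr ?ratio//.
by rewrite addmx_subl.
Qed.

Lemma exists_functional m u (A : 'M[F]_(m, N)) : ~~ (u <= A)%MS ->
  exists2 f : 'cV[F]_N, A *m f = 0 & u *m f != 0.
Proof.
rewrite submxE => uA; have [j uj] : exists j, (u *m cokermx A) 0 j != 0.
  by apply/existsP; apply: contraR uA => /existsPn u0; apply/eqP/rowP => j;
     rewrite [RHS]mxE; apply/eqP; move: (u0 j); rewrite negbK.
exists (col j (cokermx A)); first by rewrite colE mulmxA mulmx_coker mul0mx.
apply: contra uj; rewrite colE mulmxA -colE => /eqP/colP/(_ 0).
by rewrite !mxE => ->.
Qed.

Lemma exists_functional2 m u v (A : 'M[F]_(m, N)) :
  ~~ (u <= A)%MS -> ~~ (v <= A)%MS ->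
  exists f : 'cV[F]_N, [/\ A *m f = 0, u *m f = 1 & v *m f != 0].
Proof.
move=> /exists_functional[f Af uf] /exists_functional[g Ag vg].
suff [k [Ak uk vk]] : exists k : 'cV[F]_N,
    [/\ A *m k = 0, u *m k != 0 & v *m k != 0].
  have u0 : (u *m k) 0 0 != 0.
    by apply: contra uk => /eqP u0; rewrite [_ *m k]mx11_scalar u0 raddf0.
  exists (((u *m k) 0 0)^-1 *: k); rewrite -!scalemxAr Ak scaler0; split => //.
    by rewrite [_ *m k]mx11_scalar mxE mulr1n scale_scalar_mx mulVf.
  by rewrite scaler_eq0 invr_eq0 (negbTE u0).
have [vf|vf] := eqVneq (v *m f) 0; last by exists f.
have [ug|ug] := eqVneq (u *m g) 0; last by exists g.
by exists (f + g); rewrite !mulmxDr Af Ag vf ug !addr0 add0r.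
Qed.

(** A rank-one perturbation [1 + f (v - u)] works: [f] vanishes on [A] and is 1 at [u]. It is
    invertible because [f] is nonzero at [v]. *)
Lemma exists_unit_fixing m u v (A : 'M[F]_(m, N)) :
  ~~ (u <= A)%MS -> ~~ (v <= A)%MS ->
  exists t : 'M[F]_N, [/\ t \in unitmx, A *m t = A & u *m t = v].
Proof.
move=> uA vA; have [f [Af uf vf]] := exists_functional2 uA vA.
exists (1%:M + f *m (v - u)); split.
- set b := (v *m f) 0 0.
  have vfE : v *m f = b%:M by rewrite [LHS]mx11_scalar.
  have b0 : b != 0 by apply: contra vf => /eqP b0; rewrite vfE b0 raddf0.
  set M := f *m (v - u).
  have MM : M *m M = (b - 1) *: M.
    rewrite /M -mulmxA (mulmxA (v - u)) mulmxBl uf vfE.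
    by rewrite -raddfB /= mul_scalar_mx -scalemxAr.
  suff /mulmx1_unit[] : (1%:M + M) *m (1%:M - b^-1 *: M) = 1%:M by [].
  rewrite mulmxDl mul1mx mulmxBr mulmx1 -scalemxAr MM scalerA mulrBr mulVf//.
  by rewrite mulr1 scalerBl scale1r opprB (addrCA M) subrr addr0 subrK.
- by rewrite mulmxDr mulmx1 mulmxA Af mul0mx addr0.
- by rewrite mulmxDr mulmx1 mulmxA uf mul1mx addrC subrK.
Qed.

End RowSpaces.

(** In a pair [(s, c)] the constant follows the letter. Only constants between mutually inverse
    letters are constrained, so the last one is free. *)
Fixpoint reduced (S C : Type) (P : C -> Prop) (L : seq (S * bool * C)) : Prop :=
  if L is (s, c) :: L' then
    (if L' is (s', _) :: _ then s' = (s.1, ~~ s.2) -> P c else True) /\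
    reduced P L'
  else True.

(** * Trajectories of partially defined words *)

Section Trajectories.
Variables (F : fieldType) (N : nat) (I : eqType).
Implicit Types (u v z : 'rV[F]_N) (A W c : 'M[F]_N) (h D : I -> 'M[F]_N).
Implicit Types (s t : I * bool) (L : seq (I * bool * 'M[F]_N)).
Local Open Scope ring_scope.

Definition mx_letter h s := if s.2 then invmx (h s.1) else h s.1.

Definition mx_word h L :=
  foldr (fun l M => mx_letter h l.1 *m l.2 *m M) 1%:M L.

Definition all_unitmx h := forall i, h i \in unitmx.

(** A pair [h], [D] encodes partial isomorphisms as restrictions of units; the values of [h i] off
    [D i] are placeholders that later extensions may change. *)
Definition agree_on D h h' :=
  all_unitmx h' /\ forall i, D i *m h' i = D i *m h i.

(* The domain of the letter [s] when each [h i] is only known on [D i]. *)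
Definition letter_dom h D s := if s.2 then D s.1 *m h s.1 else D s.1.

Lemma eq_mulmx_sub m1 m2 (A : 'M[F]_(m1, N)) (B : 'M[F]_(m2, N)) c c' :
  (A <= B)%MS -> B *m c = B *m c' -> A *m c = A *m c'.
Proof. by move=> /submxP[X ->] Bc; rewrite -!mulmxA Bc. Qed.

Lemma exists_unit_extending c A u v : c \in unitmx -> ~~ (u <= A)%MS ->
  ~~ (v <= A *m c)%MS ->
  exists c', [/\ c' \in unitmx, A *m c' = A *m c & u *m c' = v].
Proof.
move=> cU uA vA; have [|t [tU At ut]] := exists_unit_fixing (u := u *m c) _ vA.
  by rewrite mulmx_sub_invmx// mulmxK.
by exists (c *m t); rewrite unitmx_mul cU tU !mulmxA.
Qed.

(** Sending [u] to [v] by [s] adds [u], already in [W], to the domain of [s], and [v] to the domain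
    of the inverse letter. Hence only the inverse letter can have a domain leaving [W]. *)
Lemma extend_letter h D W s u v : all_unitmx h ->
    (forall t, (letter_dom h D t <= W)%MS) -> (u <= W)%MS -> ~~ (v <= W)%MS ->
    ~~ (u <= letter_dom h D s)%MS ->
  exists h' D', [/\ all_unitmx h',
    forall h'', agree_on D' h' h'' ->
      agree_on D h h'' /\ u *m mx_letter h'' s = v,
    forall t, (letter_dom h' D' t <= W + v)%MS &
    forall t, t <> (s.1, ~~ s.2) -> (letter_dom h' D' t <= W)%MS].
Proof.
case: s => i b /= hU hW uW vW ub.
have vdom t : ~~ (v <= letter_dom h D t)%MS.
  by apply: contra vW => /submx_trans; apply.
have [x [y [xy xD yD]]] : exists x y, [/\ (x, y) = if b then (v, u) else (u, v),
    ~~ (x <= D i)%MS & ~~ (y <= D i *m h i)%MS].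
  case: b ub => ub; [exists v, u | exists u, v]; split=> //.
    exact: (vdom (i, false)).
  exact: (vdom (i, true)).
have [c [cU Dc xc]] := exists_unit_extending (hU i) xD yD.
pose h' j := if j == i then c else h j.
pose D' j := if j == i then (D i + x)%MS else D j.
have h'W t : t <> (i, ~~ b) -> (letter_dom h' D' t <= W)%MS.
  case: t => j d; rewrite /letter_dom /h' /D' /=.
  case: (eqVneq j i) => [-> tb|ji _]; last exact: (hW (j, d)).
  have -> : d = b by case: (d) (b) tb => -[].
  have := hW (i, b); rewrite /letter_dom /=.
  case: b xy {ub tb h'} => -[xE yE] Wb; last by rewrite addsmx_sub Wb xE.
  by rewrite addsmxMr addsmx_sub Dc Wb xc yE.
exists h', D'; split=> // [j|h'' [h''U h''D]|[j d]].
- by rewrite /h'; case: eqP => // _; exact: hU.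
- split; first split=> // j.
    have -> : D j *m h j = D j *m h' j by rewrite /h'; case: eqP => [->|].
    apply: eq_mulmx_sub (h''D j).
    by rewrite /D'; case: eqP => [->|]; rewrite ?addsmxSl.
  have : x *m h'' i = y.
    rewrite -xc; have <- : h' i = c by rewrite /h' eqxx.
    by apply: eq_mulmx_sub (h''D i); rewrite /D' eqxx addsmxSr.
  rewrite /mx_letter /=; case: b xy {ub h'W} => -[-> ->] // <-.
  by rewrite mulmxK// h''U.
have [jd|/eqP/h'W/submx_trans] := eqVneq (j, d) (i, ~~ b);
  last by apply; exact: addsmxSl.
case: jd => -> ->; rewrite /letter_dom /h' /D' /= eqxx.
have := hW (i, ~~ b); rewrite /letter_dom /=.
case: b xy {ub h'W} => -[xE yE] Wb; first by rewrite xE addsmxS.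
by rewrite addsmxMr addsmxS// ?Dc ?xc ?yE.
Qed.

(** Each letter costs two dimensions, for its image [v] and for [v c]. The invariant is that all
    domains lie in [W] while the current point lies outside the domain of the next letter. *)
Lemma trajectory (K : nat) L : (K <= N)%N -> L <> [::] ->
    (forall l, l \in L -> l.2 \in unitmx) ->
    reduced (fun c => forall a : F, (K <= \rank (c - a%:M)%R)%N) L ->
  forall h D W u, all_unitmx h ->
    (forall t, (letter_dom h D t <= W)%MS) -> (u <= W)%MS ->
    (if L is (s, _) :: _ then ~~ (u <= letter_dom h D s)%MS else true) ->
    (\rank W + 2 * size L <= K)%N ->
  exists h' D' W' z, [/\ all_unitmx h',
    forall t, (letter_dom h' D' t <= W')%MS,
    (W + z <= W')%MS /\ (\rank W' <= \rank W + 2 * size L)%N,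
    ~~ (z <= W)%MS &
    forall h'', agree_on D' h' h'' ->
      agree_on D h h'' /\ u *m mx_word h'' L = z].
Proof.
move=> KN; elim: L => // -[s c] L IH _ cU [crit red] h D W u hU hW uW us.
rewrite [size _]/= mulnS addnA => rW.
have rWK : ((\rank W).+1 < K)%N by rewrite -addn2 (leq_trans _ rW) ?leq_addr.
have cu : c \in unitmx by apply: (cU (s, c)); rewrite mem_head.
(* Avoiding [W] keeps [v c] off the domain of the next letter unless that letter is inverse to [s];
   then [W + <v>] must be avoided, which criticality of [c] permits. *)
have [v [vW vc vcW]] : exists v, [/\ ~~ (v <= W)%MS, ~~ (v *m c <= W)%MS &
    (if L is (s', _) :: _
     then s' = (s.1, ~~ s.2) -> ~~ (v *m c <= W + v)%MS else true)].
  case: L crit {IH cU red rW} => [|[s' c'] L] crit.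
    have [||v vW vc] := @exists_moved _ _ c W => //; last by exists v.
    by rewrite (leq_trans _ KN)// ltnW.
  have [/crit rc|ns] := eqVneq s' (s.1, ~~ s.2).
    have [||v vW vc] := @exists_moved_mod _ _ c W.
    - exact: leq_trans KN.
    - by move=> a; apply: leq_trans (rc a); apply: ltnW.
    exists v; split=> //; apply: contra vc => /submx_trans; apply.
    exact: addsmxSl.
  have [||v vW vc] := @exists_moved _ _ c W => //.
    by rewrite (leq_trans _ KN)// ltnW.
  by exists v; split=> // /eqP; rewrite (negbTE ns).
have [h1 [D1 [h1U agr h1v h1W]]] := extend_letter hU hW uW vW us.
pose W1 := (W + v + v *m c)%MS.
have WW1 : (W <= W1)%MS by rewrite /W1 -addsmxA addsmxSl.
have rW1 : (\rank W1 <= \rank W + 2)%N.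
  rewrite addn2; apply: leq_trans (rank_adds_row _ _) _.
  by rewrite ltnS rank_adds_row.
have h1W1 t : (letter_dom h1 D1 t <= W1)%MS.
  by rewrite (submx_trans (h1v t)) ?addsmxSl.
case: (eqVneq L [::]) => [L0|/eqP L0].
  exists h1, D1, W1, (v *m c); split=> //; last first.
    by move=> h'' /agr[? uv]; split=> //; rewrite L0 /= mulmx1 mulmxA uv.
  split; last by rewrite L0 muln0 addn0.
  by rewrite addsmx_sub WW1 addsmxSr.
have [||||h2 [D2 [W2 [z [h2U h2W [W2W1 rW2] zW1 agr2]]]]] :=
  IH L0 _ red h1 D1 W1 (v *m c) h1U h1W1.
- by move=> l lL; apply: cU; rewrite inE lL orbT.
- exact: addsmxSr.
- case: (L) vcW => [|[s' c'] _] //= vcW.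
  have [/vcW|/eqP/h1W] := eqVneq s' (s.1, ~~ s.2).
    by apply: contra => /submx_trans; apply.
  by move=> s'W; apply: contra vc => /submx_trans; apply.
- by apply: leq_trans rW; rewrite leq_add2r.
exists h2, D2, W2, z; split=> //.
- split; last by rewrite (leq_trans rW2)// leq_add2r.
  have /andP[W1W2 zW2] : (W1 <= W2)%MS && (z <= W2)%MS by rewrite -addsmx_sub.
  by rewrite addsmx_sub (submx_trans WW1).
- by apply: contra zW1 => /submx_trans; apply.
move=> h'' /agr2[/agr[ag uv] vcz]; split=> //=.
by rewrite -vcz !mulmxA uv.
Qed.

Lemma rank_adds_notin m (A : 'M[F]_(m, N)) u :
  ~~ (u <= A)%MS -> \rank (A + u)%MS = (\rank A).+1.
Proof.
move=> uA; apply/eqP; rewrite eqn_leq; apply/andP; split.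
  exact: rank_adds_row.
have : (A < A + u)%MS by rewrite ltmxE addsmxSl addsmx_sub submx_refl.
by move/rank_ltmx.
Qed.

(** Each new start [x] and its image [x c0] avoid the space used so far, and the endpoint avoids
    even the space enlarged by them. One trajectory thus costs [2 + 2 * size L] dimensions. *)
Lemma many_trajectories (K : nat) c0 L m : (K <= N)%N -> L <> [::] ->
    c0 \in unitmx -> (forall l, l \in L -> l.2 \in unitmx) ->
    reduced (fun c => forall a : F, (K <= \rank (c - a%:M)%R)%N) L ->
    (m * (2 * size L).+2 <= K)%N ->
  exists h D W (X Z : 'M_(m, N)), [/\ all_unitmx h,
    forall t, (letter_dom h D t <= W)%MS,
    (X + Z <= W)%MS /\ (\rank W <= m * (2 * size L).+2)%N,
    \rank (X + Z)%MS = (m + m)%N &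
    forall h', agree_on D h h' -> X *m (c0 *m mx_word h' L) = Z].
Proof.
move=> KN L0 c0U cU red; elim: m => [_|m IH].
  exists (fun=> 1%:M), (fun=> 0), 0, 0, 0.
  split.
  - by move=> i; rewrite unitmx1.
  - by case=> i b; rewrite /letter_dom mul0mx if_same sub0mx.
  - by rewrite addsmx0 sub0mx mxrank0.
  - by rewrite addsmx0 mxrank0.
  - by move=> h' _; rewrite mul0mx.
rewrite mulSn => mK.
have [|h [D [W [X [Z [hU hW [XZW rW] rXZ XwZ]]]]]] := IH.
  by apply: leq_trans mK; rewrite leq_addl.
have rWK : ((\rank W).+2 + 2 * size L <= K)%N.
  by apply: leq_trans mK; rewrite !addSn !ltnS [leqRHS]addnC leq_add2r.
have [||x xW xcW] := @exists_moved _ _ c0 W => //.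
  by rewrite (leq_trans _ KN)// (leq_trans _ rWK)// !addSn ltnS leqW ?leq_addr.
pose W1 := (W + x + x *m c0)%MS.
have rW1 : (\rank W1 <= (\rank W).+2)%N.
  by apply: leq_trans (rank_adds_row _ _) _; rewrite ltnS rank_adds_row.
have WW1 : (W <= W1)%MS by rewrite /W1 -addsmxA addsmxSl.
have xW1 : (x <= W1)%MS by rewrite /W1 (submx_trans _ (addsmxSl _ _))// addsmxSr.
have [||||h1 [D1 [W2 [z [h1U h1W [W2W1 rW2] zW1 agr]]]]] :=
  @trajectory K L KN L0 cU red h D W1 (x *m c0) hU.
- by move=> t; apply: submx_trans (hW t) WW1.
- exact: addsmxSr.
- case: (L) => [|[s c] _] //; apply: contra xcW => /submx_trans; apply; exact: hW.
- by apply: leq_trans rWK; rewrite leq_add2r.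
have /andP[W1W2 zW2] : (W1 <= W2)%MS && (z <= W2)%MS by rewrite -addsmx_sub.
have /andP[XW ZW] : (X <= W)%MS && (Z <= W)%MS by rewrite -addsmx_sub.
have sub2 k (B : 'M[F]_(k, N)) : (B <= W)%MS -> (B <= W2)%MS.
  by move=> /submx_trans/(_ WW1)/submx_trans; apply.
have Xx : (col_mx x X :=: x + X)%MS by apply/eqmx_sym/addsmxE.
have Zz : (col_mx z Z :=: z + Z)%MS by apply/eqmx_sym/addsmxE.
exists h1, D1, W2, (col_mx x X), (col_mx z Z); split=> //.
- split.
    rewrite (adds_eqmx Xx Zz) !addsmx_sub.
    by rewrite (submx_trans xW1)// zW2 !sub2.
  apply: leq_trans rW2 _.
  rewrite mulSn addSn addSn -addnS -addnS [leqRHS]addnC leq_add2r.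
  by rewrite (leq_trans rW1).
- have -> : \rank (col_mx x X + col_mx z Z)%MS = \rank (X + Z + x + z)%MS.
    rewrite (adds_eqmx Xx Zz); congr (\rank _).
    by rewrite [(X + Z + x)%MS]addsmxC !addsmxA -!addsmxA [(Z + z)%MS]addsmxC.
  rewrite rank_adds_notin ?rank_adds_notin ?rXZ ?addSn ?addnS//.
    by apply: contra xW => /submx_trans; apply.
  apply: contra zW1 => /submx_trans; apply.
  by rewrite addsmx_sub xW1 andbT (submx_trans XZW).
move=> h' /agr[/XwZ XZ xz].
have -> := mul_col_mx x X (c0 *m mx_word h' L).
by rewrite XZ mulmxA xz.
Qed.

(** By independence some [E] kills [X] and sends [Z] to [X], with [E] of square zero. For
    [g = 1 + E] and [X w = Z], the commutator [w g - g w] fixes the rows of [X], so its rank is at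
    least [m]. *)
Lemma exists_far_from_commuting (K : nat) c0 L m : (K <= N)%N -> L <> [::] ->
    c0 \in unitmx -> (forall l, l \in L -> l.2 \in unitmx) ->
    reduced (fun c => forall a : F, (K <= \rank (c - a%:M)%R)%N) L ->
    (m * (2 * size L).+2 <= K)%N ->
  exists h g, [/\ all_unitmx h, g \in unitmx &
    let w := c0 *m mx_word h L in (m <= \rank (w *m g - g *m w)%R)%N].
Proof.
move=> KN L0 c0U cU red mK.
have [h [D [_ [X [Z [hU _ _ rXZ XwZ]]]]]] := many_trajectories KN L0 c0U cU red mK.
have {XwZ} XwZ := XwZ h (conj hU (fun=> erefl)).
have /row_freeP[B XZB] : row_free (col_mx X Z) by rewrite /row_free -addsmxE rXZ.
have [XB ZB] : X *m rsubmx B = 0 /\ Z *m rsubmx B = 1%:M.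
  move: XZB; rewrite -[B]hsubmxK mul_col_row scalar_mx_block row_mxKr.
  by case/eq_block_mx.
pose E := rsubmx B *m X.
have EE : E *m E = 0 by rewrite /E mulmxA -(mulmxA _ X) XB mulmx0 mul0mx.
have XE : X *m E = 0 by rewrite mulmxA XB mul0mx.
have ZE : Z *m E = X by rewrite mulmxA ZB mul1mx.
exists h, (1%:M + E); split=> //=.
  suff /mulmx1_unit[] : (1%:M + E) *m (1%:M - E) = 1%:M by [].
  by rewrite mulmxDl mul1mx mulmxBr mulmx1 EE subr0 subrK.
move: (c0 *m _) XwZ => w XwZ.
have Xcomm : X *m (w *m (1%:M + E) - (1%:M + E) *m w) = X.
  rewrite mulmxBr mulmxA XwZ mulmxDr ZE (mulmxA X) mulmxDr !mulmx1 XE addr0 XwZ.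
  by rewrite addrC addKr.
have rX : \rank X = m.
  apply/eqP; rewrite eqn_leq rank_leq_row /= -(leq_add2r m) -rXZ.
  by rewrite (leq_trans (mxrank_adds_leqif _ _).1)// leq_add2l rank_leq_row.
by rewrite -{1}rX -{1}Xcomm mxrankM_maxr.
Qed.

End Trajectories.

(** * Words over groups *)

Section GroupWords.
Variable I : Type.
Implicit Types K : groupType.
Local Open Scope group_scope.

Definition letter_value K (h : I -> K) (s : I * bool) :=
  if s.2 then (h s.1)^-1 else h s.1.

Definition word_value K (h : I -> K) (L : seq (I * bool * K)) :=
  foldr (fun l x => letter_value h l.1 * l.2 * x) 1 L.

Definition map_const (C C' : Type) (f : C -> C') (L : seq (I * bool * C)) :=
  [seq (l.1, f l.2) | l <- L].

Lemma morph_one K K' (f : K -> K') : {morph f : x y / x * y} -> f 1 = 1.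
Proof. by move=> fM; apply: (mulgI (f 1)); rewrite -fM !mulg1. Qed.

Lemma morph_inv K K' (f : K -> K') : {morph f : x y / x * y} ->
  {morph f : x / x^-1}.
Proof.
by move=> fM x; apply: (mulgI (f x)); rewrite -fM !mulgV morph_one.
Qed.

Lemma morph_word_value K K' (f : K -> K') (h : I -> K) L :
    {morph f : x y / x * y} ->
  f (word_value h L) = word_value (f \o h) (map_const f L).
Proof.
move=> fM; elim: L => [|l L IH] /=; first exact: morph_one.
by rewrite !fM IH /letter_value; case: l.1.2; rewrite ?morph_inv.
Qed.

Lemma reduced_map (C C' : Type) (f : C -> C') (P : C -> Prop) (Q : C' -> Prop)
    (L : seq (I * bool * C)) :
  (forall c, P c -> Q (f c)) -> reduced P L -> reduced Q (map_const f L).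
Proof.
move=> PQ; elim: L => //= -[s c] L IH [Pc redL]; split; last exact: IH.
by case: L Pc {IH redL} => //= -[s' c'] L Pc /Pc/PQ.
Qed.

Lemma reducedW (C : Type) (P Q : C -> Prop) (L : seq (I * bool * C)) :
  (forall d, P d -> Q d) -> reduced P L -> reduced Q L.
Proof.
move=> PQ /(reduced_map PQ); suff -> : map_const id L = L by [].
by rewrite /map_const -[RHS]map_id; apply: eq_map => -[].
Qed.

End GroupWords.

(** * Reduced forms in the free product with a free group *)

Section NormalForm.
Variables (G : groupType) (r : nat).
Local Open Scope group_scope.
Local Open Scope quotient_scope.
Local Notation FP := (free_product G (free_group r)).

Lemma presented_piM (S : choiceType) (R : gword S -> gword S -> Prop)
    (u v : gword S) :
  \pi_(presented R) (u ++ v) =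
    (\pi_(presented R) u : presented R) * \pi_(presented R) v.
Proof. by rewrite -pres_mulE. Qed.

Lemma presented_letterV (S : choiceType) (R : gword S -> gword S -> Prop)
    (s : S) :
  \pi_(presented R) [:: (s, true)] = (pres_gen R s)^-1.
Proof. by rewrite [RHS]pres_invE. Qed.

Lemma fp_inlM (H K : groupType) : {morph @fp_inl H K : a b / a * b}.
Proof.
move=> a b; rewrite -[RHS]presented_piM; apply/esym/presentedP.
exact/word_congr_rel/free_product_rel_l.
Qed.

Lemma fp_inrM (H K : groupType) : {morph @fp_inr H K : a b / a * b}.
Proof.
move=> a b; rewrite -[RHS]presented_piM; apply/esym/presentedP.
exact/word_congr_rel/free_product_rel_r.
Qed.

Let X (i : 'I_r) : FP := fp_inr G (fg_var i).
Let eval c L : FP := fp_inl _ c * word_value X (map_const (@fp_inl G _) L).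

Lemma free_product_normal_form (w : FP) : exists c L,
  reduced (fun a : G => a <> 1) L /\
  w = fp_inl _ c *
    word_value (fun i => fp_inr G (fg_var i)) (map_const (@fp_inl G _) L).
Proof.
pose nf w := exists c L, reduced (fun a : G => a <> 1) L /\ w = eval c L.
have inl1 : fp_inl (free_group r) (1 : G) = 1.
  exact: morph_one (@fp_inlM _ _).
have inr1 : fp_inr G (1 : free_group r) = 1.
  exact: morph_one (@fp_inrM _ _).
have nf1 : nf 1 by exists 1, [::]; rewrite /eval /= inl1 mulg1.
have nfl a x : nf x -> nf (fp_inl _ a * x).
  by move=> [c [L [redL ->]]]; exists (a * c), L; rewrite /eval fp_inlM mulgA.
have nfX s x : nf x -> nf (letter_value X s * x).
  move=> [c [L [redL ->]]].
  (* A new letter cancels exactly when a trivial constant separates it from its inverse; otherwise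
     prepending it keeps the word reduced. *)
  have [[L' [c' [-> LE]]]|nc] := pselect (exists L' c',
      c = 1 /\ L = ((s.1, ~~ s.2), c') :: L').
    exists c', L'; split; first by move: redL; rewrite LE => -[].
    rewrite /eval LE inl1 mul1g /= !mulgA.
    suff -> : letter_value X s * letter_value X (s.1, ~~ s.2) = 1.
      by rewrite mul1g.
    by rewrite /letter_value /=; case: s.2; rewrite ?mulgV ?mulVg.
  exists 1, ((s, c) :: L); split; last by rewrite /eval inl1 mul1g /= !mulgA.
  split=> //; case: L redL nc => // -[s' c'] L _ nc s'E c1.
  by apply: nc; exists L, c'; rewrite s'E.
have nfF (f : free_group r) x : nf x -> nf (fp_inr _ f * x).
  elim/presentedW: f => u; elim: u => [|[i b] u IH] nfx.
    by rewrite [fp_inr _ _]inr1 mul1g.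
  rewrite -cat1s presented_piM fp_inrM -mulgA.
  suff -> : fp_inr G (\pi_(free_group r) [:: (i, b)]) = letter_value X (i, b).
    exact/nfX/IH.
  rewrite /letter_value /=; case: b; last by [].
  by rewrite presented_letterV (morph_inv (@fp_inrM _ _)).
suff : nf w by [].
elim/presentedW: w => u; elim: u => [|[[a|f] b] u IH]; first exact: nf1.
- rewrite -cat1s presented_piM.
  suff [a' ->] : exists a', \pi_(FP) [:: (inl a, b)] = fp_inl _ a' by apply: nfl.
  case: b; last by exists a.
  by exists a^-1; rewrite presented_letterV (morph_inv (@fp_inlM _ _)).
- rewrite -cat1s presented_piM.
  suff [f' ->] : exists f', \pi_(FP) [:: (inr f, b)] = fp_inr _ f' by apply: nfF.
  case: b; last by exists f.
  by exists f^-1; rewrite presented_letterV (morph_inv (@fp_inrM _ _)).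
Qed.

End NormalForm.

(** * The inductive limit and its completion *)

Section FarFromCommuting.
Variables (F : finFieldType) (I : eqType).
Implicit Types (s : I * bool).
Local Open Scope group_scope.

Definition far_from_center (a : nat) (c : GLlim F) :=
  exists g : GLlim F, ((2 ^- a : rat) <= mdist (c * g)%g (g * c)%g)%R.

Lemma rank_commutator_scalar N (c g : 'M[F]_N) (x : F) :
  (\rank (c *m g - g *m c)%R <= 2 * \rank (c - x%:M)%R)%N.
Proof.
have -> : (c *m g - g *m c = (c - x%:M) *m g - g *m (c - x%:M))%R.
  by rewrite mulmxBl mulmxBr mul_mx_scalar mul_scalar_mx opprB addrA subrK.
rewrite mul2n -addnn (leq_trans (mxrank_add _ _))// mxrank_opp.
by rewrite leq_add ?mxrankM_maxl ?mxrankM_maxr.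
Qed.

(** The commutator of [c] with [g] is unchanged when a scalar is subtracted from [c], so its rank is
    at most twice that of the difference. This factor 2 turns [a] into [a.+1]. *)
Lemma far_from_center_rank a c : far_from_center a c ->
  exists M0, forall M, (M0 <= M)%N -> forall c' : {'GL_(2 ^ M)[F]},
    c = GLlim_in c' -> forall x : F,
    (2 ^ (M - a.+1) <= \rank (GLval c' - x%:M)%R)%N.
Proof.
case=> g cg; have [M0 gM0] := GLlim_lvl g; exists (maxn M0 a.+1) => M.
rewrite geq_max => /andP[/gM0[g' gE] aM] c' cE x.
move: cg; rewrite cE gE -!GLlim_morphM GLlim_mdistE /rank_dist !GL_MxE.
rewrite ler_pdivlMr ?exprn_gt0// mulrC -expfB// -natrX ler_nat => /leq_trans.
move=> /(_ _ (rank_commutator_scalar _ _ x)); rewrite -(subnSK aM) expnS.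
by rewrite leq_pmul2l.
Qed.

Lemma GLlim_word_lvl a (L : seq (I * bool * GLlim F)) :
  reduced (far_from_center a) L ->
  exists M0, forall M, (M0 <= M)%N ->
    exists L' : seq (I * bool * {'GL_(2 ^ M)[F]}),
    L = map_const (@GLlim_in F M) L' /\
    reduced (fun c => forall x : F,
      (2 ^ (M - a.+1) <= \rank (GLval c - x%:M)%R)%N) L'.
Proof.
elim: L => [_|[s c] L IH /= [Lc /IH[M1 LM1]]].
  by exists 0%N => M _; exists [::].
have [M2 cM2] := GLlim_lvl c.
have [M3 cM3] : exists M3, forall M, (M3 <= M)%N -> forall c' : {'GL_(2 ^ M)[F]},
    c = GLlim_in c' ->
    if L is (s', _) :: _ then s' = (s.1, ~~ s.2) -> forall x : F,
      (2 ^ (M - a.+1) <= \rank (GLval c' - x%:M)%R)%N else True.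
  case: L Lc {IH LM1} => [_|[s' c'] L Lc]; first by exists 0%N.
  have [/Lc/far_from_center_rank[M3 cM3]|ns] := eqVneq s' (s.1, ~~ s.2).
    by exists M3 => M M3M d cE _; exact: cM3.
  by exists 0%N => M _ d _ /eqP; rewrite (negbTE ns).
exists (maxn M1 (maxn M2 M3)) => M; rewrite !geq_max.
move=> /and3P[/LM1[L' [LE red]] /cM2[c' cE] M3M].
exists ((s, c') :: L'); split; first by rewrite /= -cE -LE.
split=> //; have := cM3 M M3M c' cE.
by rewrite LE; case: (L') => [|[]].
Qed.

Lemma mx_word_GL M (h : I -> {'GL_(2 ^ M)[F]}) L :
  GLval (word_value h L) =
    mx_word (fun i => GLval (h i)) (map_const (@GLval _ F) L).
Proof.
elim: L => [|[[i b] c] L IH]; first by [].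
rewrite [word_value _ _]/= !GL_MxE IH /=; congr (_ *m _ *m _)%R.
by rewrite /letter_value /mx_letter /=; case: b.
Qed.

(** With [K = 2 ^ (M - a.+1)] there is room for [2 ^ (M - (a.+1 + b))] trajectories, since [2 ^ b]
    bounds the cost of one; normalizing by [2 ^ M] removes the level. *)
Lemma GLlim_word_far a b c0 (L : seq (I * bool * GLlim F)) : L <> [::] ->
  reduced (far_from_center a) L -> ((2 * size L).+2 <= 2 ^ b)%N ->
  exists (h : I -> GLlim F) (g : GLlim F), let w := c0 * word_value h L in
    ((2 ^- (a.+1 + b) : rat) <= mdist (w * g)%g (g * w)%g)%R.
Proof.
move=> L0 /GLlim_word_lvl[M1 LM1] Lb; have [M2 c0M2] := GLlim_lvl c0.
pose M := maxn (a.+1 + b) (maxn M1 M2).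
have [abM M1M M2M] : [/\ a.+1 + b <= M, M1 <= M & M2 <= M]%N.
  by rewrite /M !leq_max !leqnn !orbT.
have [L' [LE red]] := LM1 M M1M; have [c0' c0E] := c0M2 M M2M.
have [||||||h [g [hU gU wg]]] := @exists_far_from_commuting F (2 ^ M).-1.+1 I
    (2 ^ (M - a.+1)) (GLval c0') (map_const (@GLval _ F) L') (2 ^ (M - (a.+1 + b))).
- by rewrite prednK ?expn_gt0// leq_exp2l// leq_subr.
- by move=> L'0; apply: L0; rewrite LE; case: (L') L'0.
- exact: GL_unitmx.
- by move=> l /mapP[l' _ ->]; exact: GL_unitmx.
- exact: reduced_map red.
- have -> : size (map_const (@GLval _ F) L') = size L by rewrite LE !size_map.
  rewrite (leq_trans (leq_mul (leqnn _) Lb))// -expnD leq_exp2l//.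
  by rewrite subnDA subnK// leq_subRL// (leq_trans _ abM) ?leq_addr.
pose h' i : {'GL_(2 ^ M)[F]} := FinRing.unit _ (hU i).
pose g' : {'GL_(2 ^ M)[F]} := FinRing.unit _ gU.
exists (fun i => GLlim_in (h' i)), (GLlim_in g') => w.
have -> : w = GLlim_in (c0' * word_value h' L').
  by rewrite GLlim_morphM (morph_word_value _ _ (@GLlim_morphM F M)) /w c0E LE.
rewrite -!GLlim_morphM GLlim_mdistE /rank_dist !GL_MxE mx_word_GL.
rewrite ler_pdivlMr ?exprn_gt0// mulrC -expfB_cond ?pnatr_eq0//.
by rewrite -natrX ler_nat; exact: wg.
Qed.

End FarFromCommuting.

(** * Words with constants in the completion *)

Section WordsInCompletion.
Variables (F : finFieldType) (I : eqType).
Implicit Types (s : I * bool) (c x y : Aq F).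
Local Open Scope group_scope.
Local Open Scope quotient_scope.

Lemma Aq_mulE (x y : cauchy_sequence (GLlim F)) :
  \pi_(Aq F) (cauchy_mul x y) = (\pi_(Aq F) x : Aq F) * \pi_(Aq F) y.
Proof. by rewrite -completion_mulE. Qed.

Definition approx c n : GLlim F := val (repr c) n.

Lemma approx_cauchy c (e : rat) : (0 < e)%R ->
  exists N, forall m n, (N <= m)%N -> (N <= n)%N ->
    (mdist (approx c m) (approx c n) < e)%R.
Proof. by move: e; apply/cauchy_seqP/asboolP/(valP (repr c)). Qed.

Lemma exists_exprV_le (e : rat) : (0 < e)%R -> exists a, (2 ^- a <= e)%R.
Proof.
move=> e0; exists (Num.bound e^-1).
rewrite -[leRHS]invrK lef_pV2 ?posrE ?invr_gt0 ?exprn_gt0//.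
by rewrite ltW// upper_nthrootP.
Qed.

Lemma noncentral_approx c : c \notin @center (Aq F) ->
  exists a N, forall n, (N <= n)%N -> far_from_center a (approx c n).
Proof.
move=> cZ; have [y cy] : exists y, c * y <> y * c.
  apply: contrapT => ncy; move/negP: cZ; apply; apply/centerP => y.
  by apply: contrapT => ?; apply: ncy; exists y.
have [e e0 fe] : exists2 e : rat, (0 < e)%R & forall N, exists2 n, (N <= n)%N &
    (e <= mdist (approx c n * approx y n)%g (approx y n * approx c n)%g)%R.
  apply: contrapT => ne; apply: cy.
  rewrite -[c]reprK -[y]reprK -!Aq_mulE; apply/completionP/null_distP => e e0.
  apply: contrapT => nN; apply: ne; exists e => // N.
  apply: contrapT => nn; apply: nN; exists N => n Nn.
  by rewrite ltNge; apply/negP => en; apply: nn; exists n.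
(* Passing from index [m] to [n] changes four factors, each by less than [e / 8], so at least
   [e / 2] of the distance remains. *)
have e8 : (0 < e / 8)%R by rewrite divr_gt0.
have [N1 cN1] := approx_cauchy c e8; have [N2 yN2] := approx_cauchy y e8.
have e2 : (0 < e / 2)%R by rewrite divr_gt0.
have [a ae] := exists_exprV_le e2.
exists a, (maxn N1 N2) => n; rewrite geq_max => /andP[N1n N2n].
have [m] := fe (maxn N1 N2); rewrite geq_max => /andP[N1m N2m] em.
exists (approx y n); apply: le_trans ae _.
have d1 := mdistMM (approx c m) (approx c n) (approx y m) (approx y n).
have d2 := mdistMM (approx y n) (approx y m) (approx c n) (approx c m).
have t1 := metric_triangle (approx c m * approx y m) (approx c n * approx y n)
  (approx y m * approx c m).
have t2 := metric_triangle (approx c n * approx y n) (approx y n * approx c n)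
  (approx y m * approx c m).
have c1 := cN1 m n N1m N1n; have c2 := cN1 n m N1n N1m.
have y1 := yN2 m n N2m N2n; have y2 := yN2 n m N2n N2m.
lra.
Qed.

Lemma far_from_centerW a b (c : GLlim F) : (a <= b)%N ->
  far_from_center a c -> far_from_center b c.
Proof.
move=> ab [g cg]; exists g; apply: le_trans cg.
by rewrite lef_pV2 ?posrE ?exprn_gt0// ler_eXn2l.
Qed.

Lemma reduced_approx (L : seq (I * bool * Aq F)) :
  reduced (fun c => c \notin @center (Aq F)) L ->
  exists a N, forall n, (N <= n)%N ->
    reduced (far_from_center a) (map_const (approx^~ n) L).
Proof.
elim: L => [_|[s c] L IH /= [Lc /IH[a1 [N1 LN1]]]]; first by exists 0%N, 0%N.
have [a2 [N2 cN2]] : exists a N, forall n, (N <= n)%N ->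
    if L is (s', _) :: _
    then s' = (s.1, ~~ s.2) -> far_from_center a (approx c n) else True.
  case: L Lc {IH LN1} => [_|[s' c'] L Lc]; first by exists 0%N, 0%N.
  have [/Lc/noncentral_approx[a [N cN]]|ns] := eqVneq s' (s.1, ~~ s.2).
    by exists a, N => n /cN.
  by exists 0%N, 0%N => n _ /eqP; rewrite (negbTE ns).
exists (maxn a1 a2), (maxn N1 N2) => n; rewrite geq_max.
move=> /andP[/LN1 red /cN2 cn].
split; last by apply: reducedW red => d; apply: far_from_centerW; exact: leq_maxl.
case: (L) cn => [|[s' c'] L'] //= cn /cn; apply: far_from_centerW; exact: leq_maxr.
Qed.

(* Uniformity in [h] is essential: [h] is chosen after the approximation of  *)
(* the constants has been fixed.                                             *)
Lemma word_value_cauchy c0 (L : seq (I * bool * Aq F)) (e : rat) : (0 < e)%R ->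
  exists N, forall m n, (N <= m)%N -> (N <= n)%N -> forall h : I -> GLlim F,
    (mdist (approx c0 m * word_value h (map_const (approx^~ m) L))%g
           (approx c0 n * word_value h (map_const (approx^~ n) L))%g < e)%R.
Proof.
elim: L c0 e => [|[s c] L IH] c0 e e0.
  have [N c0N] := approx_cauchy c0 e0; exists N => m n Nm Nn h.
  by rewrite /= mdistMr c0N.
have e2 : (0 < e / 2)%R by rewrite divr_gt0.
have [N1 c0N1] := approx_cauchy c0 e2; have [N2 cN2] := IH c _ e2.
exists (maxn N1 N2) => m n; rewrite !geq_max => /andP[N1m N2m] /andP[N1n N2n] h /=.
rewrite -!mulgA (le_lt_trans (mdistMM _ _ _ _))// mdistMl.
by rewrite (splitr e) ltrD ?c0N1 ?cN2.
Qed.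

Lemma word_value_approx c0 (L : seq (I * bool * Aq F)) (h : I -> GLlim F) :
  exists2 x : cauchy_sequence (GLlim F),
    \pi_(Aq F) x = c0 * word_value (fun i => completion_in (h i) : Aq F) L &
    forall n, val x n = approx c0 n * word_value h (map_const (approx^~ n) L).
Proof.
elim: L c0 => [|[s c] L IH] c0.
  by exists (repr c0) => [|n]; rewrite ?reprK /= mulg1.
have [x xE xn] := IH c.
exists (cauchy_mul (repr c0) (cauchy_mul (cauchy_const (letter_value h s)) x)) => [|n].
  rewrite !Aq_mulE xE reprK /= !mulgA; congr (_ * _ * _ * _).
    rewrite -[LHS]/(completion_in _) /letter_value; case: s.2 => //.
  by rewrite [RHS]completion_invE; apply: eq_completion.
by rewrite /= xn /= !mulgA.
Qed.

Lemma Aq_word_noncentral c0 (L : seq (I * bool * Aq F)) : L <> [::] ->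
  reduced (fun c => c \notin @center (Aq F)) L ->
  exists h : I -> Aq F, c0 * word_value h L \notin @center (Aq F).
Proof.
move=> L0 /reduced_approx[a [N1 red]].
pose b := (2 * size L).+2; pose e : rat := (2 ^- (a.+1 + b))%R.
have e4 : (0 < e / 4)%R by rewrite divr_gt0// invr_gt0 exprn_gt0.
have [N2 wN2] := word_value_cauchy c0 L e4.
pose N := maxn N1 N2.
have [|||h [g wg]] := @GLlim_word_far F I a b (approx c0 N)
  (map_const (approx^~ N) L).
- by case: (L) L0.
- by apply: red; exact: leq_maxl.
- by rewrite size_map ltnW// ltn_expl.
exists (fun i => completion_in (h i)); apply/negP => /centerP/(_ (completion_in g)).
have [x <- xn] := word_value_approx c0 L h.
(* Centrality would make the two products [e / 4]-close at a late index [n]. Changing the constants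
   from index [N] to [n] costs [e / 4] on each side, so the distance at [N] would be below [e]. *)
rewrite -!Aq_mulE => /completionP/null_distP/(_ _ e4)[N3 /(_ _ (leq_maxl N3 N))] /=.
move: (maxn N3 N) (leq_maxr N3 N) => n Nn; rewrite !xn.
have N2n : (N2 <= n)%N by rewrite (leq_trans _ Nn) ?leq_maxr.
have d1 := wN2 N n (leq_maxr _ _) N2n h; have d2 := wN2 n N N2n (leq_maxr _ _) h.
move: wg; rewrite -/e; cbv zeta.
move: (approx c0 N * _) (approx c0 n * _) d1 d2 => w w' d1 d2 wg w'g.
have t1 := metric_triangle (w * g) (w' * g) (g * w).
have t2 := metric_triangle (w' * g) (g * w') (g * w).
move: t1 t2; rewrite mdistMr mdistMl => t1 t2.
clearbody e; clear -e4 d1 d2 wg w'g t1 t2; lra.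
Qed.

End WordsInCompletion.

(** * Descent to the quotient by the center *)

Theorem theorem7 (p k q : nat) (F : finFieldType)
  (hp : prime p) (hk : (0 < k)%N) (hq : q = (p ^ k)%N) (hF : #|F| = q) :
  ~ admits_mixed_identity (center_quotient (Aq F)).
Proof.
move=> [r [w [_ [w1 wh]]]].
have [c [L [red wE]]] := free_product_normal_form w.
pose P : Aq F -> center_quotient (Aq F) := \pi_(center_quotient (Aq F))%qT.
have PM : {morph P : x y / (x * y)%g} by move=> x y; exact/esym/cq_mulE.
have PK x : P (repr x) = x by exact: reprK.
have P1 x : P x = 1%g <-> x \in @center (Aq F).
  by rewrite -[1%g]/(P 1%g); split=> [/esym|xZ]; last apply/esym;
     rewrite /P center_quotientP invg1 mul1g.
have mE (h : 'I_r -> Aq F) :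
    mixed_eval (P \o h) w = P (repr c * word_value h (map_const repr L))%g.
  rewrite wE mixed_evalM mixed_eval_const (morph_word_value _ _ (mixed_evalM _)).
  rewrite PM PK (morph_word_value _ _ PM) /map_const -!map_comp.
  congr (_ * word_value _ _)%g.
    by apply/funext => i; exact: mixed_eval_var.
  by apply: eq_map => -[s d] /=; rewrite mixed_eval_const PK.
(* A word without variables is a constant equal to its own value, so as an identity it would be
   trivial. *)
have [L0|/eqP L0] := eqVneq L [::].
  apply: w1; move: (wh (fun=> 1%g)); rewrite wE L0 /= mulg1 mixed_eval_const => ->.
  exact: morph_one (@fp_inlM _ _).
have [||h /negP] := @Aq_word_noncentral F 'I_r (repr c) (map_const repr L).
- by case: (L) L0.
- by apply: reduced_map red => d d1; apply/negP => /P1; rewrite PK.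
by apply; apply/P1; rewrite -mE wh.
Qed.
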